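(* Let $X \subseteq \mathbb{R}^d$ be any dataset containing $n$ points and $k>1$ an integer. Let $C$ be the output of the algorithm Query-$k$-means++$(X,k)$. Then $\mathbf{E}[\Phi(C, X)] \leq 24 \cdot \Delta_k(X)$. Furthermore, the algorithm makes $O(k^2 \log{k})$ same-cluster queries and its running time is $O(nkd + k \log{k} \log{n} + k^2 \log{k})$.
   Context: $\Phi(C,X)=\sum_{x\in X}\min_{c\in C}\|x-c\|^2$ for nonempty $C$; $\Delta_k(X)$ is the optimal $k$-means cost $\min_{|C|=k}\Phi(C,X)$. A fixed optimal clustering $X_1,\dots,X_k$ is given implicitly; a same-cluster query on $x,y\in X$ returns whether $x,y$ lie in the same $X_i$. $D^2$-sampling w.r.t. nonempty $C$ samples $x\in X$ with probability $\Phi(C,\{x\})/\Phi(C,X)$. Algorithm Query-$k$-means++$(X,k)$: sample $x\in X$ uniformly at random and set $C\leftarrow\{x\}$; for $i=2$ to $k$: for $j=1$ to $\lceil\log k\rceil$: $D^2$-sample $x$ w.r.t. $C$; if no $c\in C$ lies in the same optimal cluster as $x$ (checked with same-cluster queries), set $C\leftarrow C\cup\{x\}$ and break out of the inner loop. Return $C$. *)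

(* Defs.v *)
From HB Require Import structures.
From mathcomp Require Import all_boot all_order all_algebra.
From mathcomp Require Import boolp classical_sets reals exp.
Set Implicit Arguments.
Unset Strict Implicit.
Unset Printing Implicit Defensive.
Import Order.TTheory GRing.Theory Num.Theory.
Local Open Scope ring_scope.

(** * k-means costs *)

(* Finite subsets of R^d are represented by duplicate-free sequences. *)

(* The squared Euclidean distance; the norm that the library puts on row
   vectors is the sup norm. *)
Definition sqdist (R : realFieldType) (d : nat) (x y : 'rV[R]_d) : R :=
  \sum_(j < d) (x 0 j - y 0 j) ^+ 2.

(* min_{c in C} |x - c|^2, for nonempty C. *)
Definition mindist (R : realFieldType) (d : nat) (C : seq 'rV[R]_d)
    (x : 'rV[R]_d) : R :=
  \big[Order.min/sqdist x (head 0 C)]_(c <- C) sqdist x c.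

Definition Phi (R : realFieldType) (d : nat) (C X : seq 'rV[R]_d) : R :=
  \sum_(x <- X) mindist C x.

(* The infimum is attained as soon as d > 0, also when X has fewer than k
   points: centers need not belong to X. *)
Definition Delta (R : realType) (d : nat) (k : nat) (X : seq 'rV[R]_d) : R :=
  inf [set Phi C X | C in [set C : seq 'rV[R]_d | uniq C /\ size C = k]]%classic.

(* The i-th cluster consists of the points of X with label i; it may be empty. *)
Definition optimal_clustering (R : realType) (d k : nat) (X : seq 'rV[R]_d)
    (cl : 'rV[R]_d -> 'I_k) : Prop :=
  \sum_(i < k) Delta 1 [seq x <- X | cl x == i] = Delta k X.

(** * Finitely supported distributions *)

(* A list of (probability, outcome) pairs, one for each sequence of random
   choices; an outcome may occur several times. *)
Definition dist (R : realFieldType) (T : Type) : Type := seq (R * T).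

Definition dret (R : realFieldType) (T : Type) (x : T) : dist R T :=
  [:: (1, x)].

Definition dbind (R : realFieldType) (T U : Type) (m : dist R T)
    (f : T -> dist R U) : dist R U :=
  flatten [seq [seq (p.1 * q.1, q.2) | q <- f p.2] | p <- m].

Definition dmap (R : realFieldType) (T U : Type) (f : T -> U) (m : dist R T) :
    dist R U :=
  [seq (p.1, f p.2) | p <- m].

Definition uniform (R : realFieldType) (T : Type) (s : seq T) : dist R T :=
  [seq ((size s)%:R^-1, x) | x <- s].

Definition expect (R : realFieldType) (T : Type) (m : dist R T) (f : T -> R) : R :=
  \sum_(p <- m) p.1 * f p.2.

Definition pmf (R : realFieldType) (T : eqType) (m : dist R T) (y : T) : R :=
  \sum_(p <- m | p.2 == y) p.1.

(* P holds in every run that has positive probability. *)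
Definition surely (R : realFieldType) (T : eqType) (m : dist R T)
    (P : T -> Prop) : Prop :=
  forall (w : R) (y : T), (w, y) \in m -> 0 < w -> P y.

(** * The algorithm *)

(* If Phi C X = 0, the quotients are undefined and the point is drawn
   uniformly. In the algorithm this can only occur when X has fewer than k
   points. *)
Definition D2_sample (R : realFieldType) (d : nat) (X C : seq 'rV[R]_d) :
    dist R 'rV[R]_d :=
  if Phi C X == 0 then uniform R X
  else [seq (Phi C [:: x] / Phi C X, x) | x <- X].

(* The computations below carry a pair (C, q), where q is the number of
   same-cluster queries made so far. Testing x against C takes one query for
   each element of C. *)
Fixpoint inner_loop (R : realFieldType) (d k : nat) (X : seq 'rV[R]_d)
    (cl : 'rV[R]_d -> 'I_k) (m : nat) (s : seq 'rV[R]_d * nat) :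
    dist R (seq 'rV[R]_d * nat) :=
  if m is m'.+1 then
    dbind (D2_sample X s.1) (fun x =>
      let q := (s.2 + size s.1)%N in
      if has (fun c => cl c == cl x) s.1 then inner_loop X cl m' (s.1, q)
      else dret R (rcons s.1 x, q))
  else dret R s.

Fixpoint outer_loop (R : realFieldType) (d k : nat) (X : seq 'rV[R]_d)
    (cl : 'rV[R]_d -> 'I_k) (m : nat) (s : seq 'rV[R]_d * nat) :
    dist R (seq 'rV[R]_d * nat) :=
  if m is m'.+1 then
    dbind (inner_loop X cl (up_log 2 k) s) (outer_loop X cl m')
  else dret R s.

Definition query_kmeanspp (R : realFieldType) (d k : nat) (X : seq 'rV[R]_d)
    (cl : 'rV[R]_d -> 'I_k) : dist R (seq 'rV[R]_d * nat) :=
  dbind (uniform R X) (fun x => outer_loop X cl k.-1 ([:: x], 0%N)).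

(** * A randomized real RAM with a same-cluster oracle *)

(* The memory consists of arrays of natural numbers and arrays of reals, each
   designated by a number; a register is the cell 0 of an array. *)

Inductive nexp : Type :=
| NConst of nat
| NGet of nat & nexp
| NAdd of nexp & nexp
| NSub of nexp & nexp
| NMul of nexp & nexp
| NHalf of nexp.

Inductive rexp : Type :=
| RZero
| RGet of nat & nexp
| RAdd of rexp & rexp
| RSub of rexp & rexp
| RMul of rexp & rexp
| RDiv of rexp & rexp.

Inductive bexp : Type :=
| NLt of nexp & nexp
| NEq of nexp & nexp
| RLt of rexp & rexp
| REq of rexp & rexp.

Inductive cmd : Type :=
| Skip
| NSet of nat & nexp & nexp  (* array, index, value *)
| RSet of nat & nexp & rexp  (* array, index, value *)
| Seq of cmd & cmd
| If of bexp & cmd & cmd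
| For of nat & nexp & cmd    (* register := 0, .., e - 1 *)
| Flip of nat & rexp         (* register := 1 with probability r, else 0 *)
| Rand of nat & nexp         (* register := uniform in {0, .., e - 1} *)
| Query of nat & nexp & nexp. (* register := answer of a same-cluster query *)

Record state (R : realFieldType) : Type := State {
  nmem : nat -> nat -> nat;
  rmem : nat -> nat -> R;
  time : nat;
  queries : nat
}.

Definition upd (T : Type) (m : nat -> nat -> T) (a i : nat) (v : T) :
    nat -> nat -> T :=
  fun b j => if (b == a) && (j == i) then v else m b j.

Definition nset (R : realFieldType) (a i v : nat) (s : state R) : state R :=
  State (upd (nmem s) a i v) (rmem s) (time s) (queries s).

Definition rset (R : realFieldType) (a i : nat) (v : R) (s : state R) : state R :=
  State (nmem s) (upd (rmem s) a i v) (time s) (queries s).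

Definition tick (R : realFieldType) (t : nat) (s : state R) : state R :=
  State (nmem s) (rmem s) (time s + t)%N (queries s).

Definition count_query (R : realFieldType) (s : state R) : state R :=
  State (nmem s) (rmem s) (time s) (queries s).+1.

Fixpoint neval (R : realFieldType) (s : state R) (e : nexp) : nat :=
  match e with
  | NConst n => n
  | NGet a i => nmem s a (neval s i)
  | NAdd e1 e2 => (neval s e1 + neval s e2)%N
  | NSub e1 e2 => (neval s e1 - neval s e2)%N
  | NMul e1 e2 => (neval s e1 * neval s e2)%N
  | NHalf e1 => (neval s e1)./2
  end.

Fixpoint reval (R : realFieldType) (s : state R) (e : rexp) : R :=
  match e with
  | RZero => 0
  | RGet a i => rmem s a (neval s i)
  | RAdd e1 e2 => reval s e1 + reval s e2
  | RSub e1 e2 => reval s e1 - reval s e2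
  | RMul e1 e2 => reval s e1 * reval s e2
  | RDiv e1 e2 => reval s e1 / reval s e2
  end.

Definition beval (R : realFieldType) (s : state R) (b : bexp) : bool :=
  match b with
  | NLt e1 e2 => (neval s e1 < neval s e2)%N
  | NEq e1 e2 => neval s e1 == neval s e2
  | RLt e1 e2 => reval s e1 < reval s e2
  | REq e1 e2 => reval s e1 == reval s e2
  end.

(* Every operation, memory access and constant costs one step. *)
Fixpoint ncost (e : nexp) : nat :=
  match e with
  | NConst _ => 1%N
  | NGet _ e1 | NHalf e1 => (ncost e1).+1
  | NAdd e1 e2 | NSub e1 e2 | NMul e1 e2 => (ncost e1 + ncost e2).+1%N
  end.

Fixpoint rcost (e : rexp) : nat :=
  match e with
  | RZero => 1%N
  | RGet _ i => (ncost i).+1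
  | RAdd e1 e2 | RSub e1 e2 | RMul e1 e2 | RDiv e1 e2 =>
      (rcost e1 + rcost e2).+1%N
  end.

Definition bcost (b : bexp) : nat :=
  match b with
  | NLt e1 e2 | NEq e1 e2 => (ncost e1 + ncost e2).+1%N
  | RLt e1 e2 | REq e1 e2 => (rcost e1 + rcost e2).+1%N
  end.

(* The relation [same] is the oracle; points are referred to by their index. *)
Fixpoint exec (R : realFieldType) (same : rel nat) (c : cmd) (s : state R) :
    dist R (state R) :=
  match c with
  | Skip => dret R (tick 1 s)
  | NSet a i e =>
      dret R (tick (ncost i + ncost e).+1%N (nset a (neval s i) (neval s e) s))
  | RSet a i e =>
      dret R (tick (ncost i + rcost e).+1%N (rset a (neval s i) (reval s e) s))
  | Seq c1 c2 => dbind (exec same c1 s) (exec same c2)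
  | If b c1 c2 =>
      exec same (if beval s b then c1 else c2) (tick (bcost b).+1 s)
  | For a e c1 =>
      foldl (fun m i => dbind m (fun s' => exec same c1 (tick 1 (nset a 0 i s'))))
        (dret R (tick (ncost e).+1 s)) (iota 0 (neval s e))
  | Flip a e =>
      let p := Order.max 0 (Order.min 1 (reval s e)) in
      let s' := tick (rcost e).+1 s in
      [:: (p, nset a 0 1 s'); (1 - p, nset a 0 0 s')]
  | Rand a e =>
      dmap (fun i => tick (ncost e).+1 (nset a 0 i s))
        (uniform R (iota 0 (neval s e)))
  | Query a e1 e2 =>
      dret R (count_query (tick (ncost e1 + ncost e2).+1%N%N
        (nset a 0 (same (neval s e1) (neval s e2)) s)))
  end.

Definition block (cs : seq cmd) : cmd := foldr Seq Skip cs.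

(** * Implementation of the algorithm on the RAM *)

(* Registers and arrays of natural numbers. *)
Definition vN := 0%N.      (* number of points (input) *)
Definition vK := 1%N.      (* number of clusters (input) *)
Definition vD := 2%N.      (* dimension (input) *)
Definition vLK := 3%N.     (* ceiling of log k *)
Definition vLN := 4%N.     (* ceiling of log n *)
Definition vPow := 5%N.
Definition vCen := 6%N.    (* array of the indices of the centers (output) *)
Definition vNC := 7%N.     (* number of centers (output) *)
Definition vX := 8%N.      (* index of the sampled point *)
Definition vDone := 9%N.
Definition vFound := 10%N.
Definition vAns := 11%N.
Definition vLo := 12%N.
Definition vHi := 13%N.
Definition vCoin := 14%N.
Definition vI := 15%N.
Definition vJ := 16%N.
Definition vT := 17%N.
Definition vS := 18%N.
Definition vC := 19%N.
Definition vB := 20%N.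

(* Registers and arrays of reals. *)
Definition aPt := 0%N.     (* coordinates of the points, row by row (input) *)
Definition aDist := 1%N.   (* squared distances to the closest center *)
Definition aSum := 2%N.    (* aSum[i] = aDist[0] + .. + aDist[i - 1] *)
Definition aAcc := 3%N.

Definition N0 : nexp := NConst 0.
Definition N1 : nexp := NConst 1.
Definition nvar (a : nat) : nexp := NGet a N0.
Definition rvar (a : nat) : rexp := RGet a N0.
Definition nassign (a : nat) (e : nexp) : cmd := NSet a N0 e.
Definition rassign (a : nat) (e : rexp) : cmd := RSet a N0 e.

(* l := ceil (log_2 v), for a register v >= 1. *)
Definition ram_log (l v : nat) : cmd := block [::
  nassign l N0;
  nassign vPow N1;
  For vI (nvar v)
    (If (NLt (nvar vPow) (nvar v))
      (block [::
        nassign vPow (NAdd (nvar vPow) (nvar vPow));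
        nassign l (NAdd (nvar l) N1)])
      Skip)].

Definition ram_coord_diff : rexp :=
  RSub (RGet aPt (NAdd (NMul (nvar vI) (nvar vD)) (nvar vJ)))
       (RGet aPt (NAdd (NMul (nvar vX) (nvar vD)) (nvar vJ))).

(* Append point vX to the centers; update distances and partial sums. *)
Definition ram_add_center : cmd := block [::
  NSet vCen (nvar vNC) (nvar vX);
  nassign vNC (NAdd (nvar vNC) N1);
  RSet aSum N0 RZero;
  For vI (nvar vN) (block [::
    rassign aAcc RZero;
    For vJ (nvar vD)
      (rassign aAcc (RAdd (rvar aAcc) (RMul ram_coord_diff ram_coord_diff)));
    If (NEq (nvar vNC) N1)
      (RSet aDist (nvar vI) (rvar aAcc))
      (If (RLt (rvar aAcc) (RGet aDist (nvar vI)))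
        (RSet aDist (nvar vI) (rvar aAcc))
        Skip);
    RSet aSum (NAdd (nvar vI) N1)
      (RAdd (RGet aSum (nvar vI)) (RGet aDist (nvar vI)))])].

(* vX := index of a D^2-sampled point, by dichotomy on the partial sums: an
   index range [lo, hi) is split at its middle, and a half is entered with
   probability proportional to its cost. *)
Definition ram_D2_sample : cmd :=
  If (REq (RGet aSum (nvar vN)) RZero)
    (Rand vX (nvar vN))
    (block [::
      nassign vLo N0;
      nassign vHi (nvar vN);
      For vB (nvar vLN)
        (If (NLt (NAdd (nvar vLo) N1) (nvar vHi))
          (block [::
            nassign vI (NHalf (NAdd (nvar vLo) (nvar vHi)));
            Flip vCoin
              (RDiv (RSub (RGet aSum (nvar vI)) (RGet aSum (nvar vLo)))
                    (RSub (RGet aSum (nvar vHi)) (RGet aSum (nvar vLo))));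
            If (NEq (nvar vCoin) N1)
              (nassign vHi (nvar vI))
              (nassign vLo (nvar vI))])
          Skip);
      nassign vX (nvar vLo)]).

(* vFound := 1 if some center is in the same cluster as point vX, else 0. *)
Definition ram_check : cmd := block [::
  nassign vFound N0;
  For vC (nvar vNC) (block [::
    Query vAns (NGet vCen (nvar vC)) (nvar vX);
    If (NEq (nvar vAns) N1) (nassign vFound N1) Skip])].

Definition ram_query_kmeanspp : cmd := block [::
  ram_log vLK vK;
  ram_log vLN vN;
  nassign vNC N0;
  Rand vX (nvar vN);
  ram_add_center;
  For vT (NSub (nvar vK) N1) (block [::
    nassign vDone N0;
    For vS (nvar vLK)
      (If (NEq (nvar vDone) N0)
        (block [::
          ram_D2_sample;
          ram_check;
          If (NEq (nvar vFound) N0)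
            (block [:: ram_add_center; nassign vDone N1])
            Skip])
        Skip)])].

Definition ram_input (R : realFieldType) (d k : nat) (X : seq 'rV[R]_d) : state R :=
  State
    (fun a i => if i == 0%N then
       (if a == vN then size X else if a == vK then k
        else if a == vD then d else 0%N)
     else 0%N)
    (fun a i => if a == aPt then
       (if insub (i %% d)%N is Some j then nth 0 X (i %/ d) 0 j else 0)
     else 0)
    0 0.

Definition ram_output (R : realFieldType) (d : nat) (X : seq 'rV[R]_d)
    (s : state R) : seq 'rV[R]_d :=
  [seq nth 0 X (nmem s vCen i) | i <- iota 0 (nmem s vNC 0)].

(* The outcomes are the triples (centers, number of queries, running time). *)
Definition ram_run (R : realFieldType) (d k : nat) (X : seq 'rV[R]_d)
    (cl : 'rV[R]_d -> 'I_k) : dist R (seq 'rV[R]_d * nat * nat) :=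
  dmap (fun s => (ram_output X s, queries s, time s))
    (exec (fun i j => cl (nth 0 X i) == cl (nth 0 X j))
      ram_query_kmeanspp (ram_input k X)).

(* Main.v *)
Require Import Defs.
From mathcomp Require Import all_boot all_order all_algebra.
From mathcomp Require Import classical_sets reals exp.
From mathcomp Require Import ring lra zify.
Import Order.TTheory GRing.Theory Num.Theory.
Local Open Scope ring_scope.
Set Implicit Arguments.
Unset Strict Implicit.
Unset Printing Implicit Defensive.

(** Approximation ratio. Split the cost of the current centers C into the part H
    of the clusters that C meets and the part U of the others, and let
    a = H + 8 (sum of Delta_1 over the clusters that C misses). A center that is
    D^2-sampled from a missed cluster A brings the cost of A down to at most
    8 Delta_1(A) in expectation, so a is a supermartingale, initially at most
    8 Delta_k(X) in expectation; hence the final cost is at most a + U in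
    expectation. If U <= H this is at most 2a. If U > H, each sample is rejected
    with probability r = H / (H + U) < 1/2, and the expected loss
    r^(ceil(log k)) U from an iteration that rejects all its samples is at most
    H / (k - 1). Over the k - 1 iterations the losses add up to at most a, whence
    the factor 3 * 8 = 24.

    Implementation. Only sampling is randomized: all other pieces of the RAM
    program are state transformers. The runs of the program and of the algorithm
    are then coupled, under an invariant that records the contents of the memory
    and bounds the clock. The dichotomy draws x with the right probability since
    the biases of the coins on its path form a telescoping product. *)

(** * Finitely supported distributions *)

Section Distributions.
Variable R : realFieldType.

Lemma dbind_dret T U (x : T) (f : T -> dist R U) : dbind (dret R x) f = f x.
Proof.
rewrite /dbind /= cats0 -[RHS]map_id; apply: eq_map => -[w y].
by rewrite mul1r.
Qed.

Lemma dbind_cat T U (m1 m2 : dist R T) (f : T -> dist R U) :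
  dbind (m1 ++ m2) f = dbind m1 f ++ dbind m2 f.
Proof. by rewrite /dbind map_cat flatten_cat. Qed.

Lemma dbindA T U V (m : dist R T) (f : T -> dist R U) (g : U -> dist R V) :
  dbind (dbind m f) g = dbind m (fun x => dbind (f x) g).
Proof.
elim: m => //= p m IHm; rewrite [LHS]dbind_cat IHm; congr (_ ++ _).
elim: (f p.2) => //= q l IHl; rewrite [LHS]/dbind /= -/(dbind _ g) IHl.
by rewrite /dbind /= map_cat -map_comp; congr (_ ++ _); apply: eq_map => o /=;
  rewrite mulrA.
Qed.

Fixpoint dfold I T (f : I -> T -> dist R T) (r : seq I) (x : T) : dist R T :=
  if r is i :: r' then dbind (f i x) (dfold f r') else dret R x.

Lemma foldl_dbind I T (f : I -> T -> dist R T) r m :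
  foldl (fun m i => dbind m (f i)) m r = dbind m (dfold f r).
Proof.
elim: r m => [|i r IHr] m /=; last by rewrite IHr dbindA.
by elim: m => // -[w x] m {1}->; rewrite /dbind /= mulr1.
Qed.

Lemma dmap_comp T U V (g : U -> V) (f : T -> U) (m : dist R T) :
  dmap g (dmap f m) = dmap (g \o f) m.
Proof. by rewrite /dmap -map_comp. Qed.

Lemma expect_dret T (x : T) (F : T -> R) : expect (dret R x) F = F x.
Proof. by rewrite /expect big_seq1 mul1r. Qed.

Lemma expect_dbind T U (m : dist R T) (f : T -> dist R U) F :
  expect (dbind m f) F = expect m (fun x => expect (f x) F).
Proof.
rewrite /expect /dbind big_flatten big_map; apply: eq_bigr => p _.
by rewrite big_map mulr_sumr; apply: eq_bigr => q _; rewrite mulrA.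
Qed.

Lemma expect_dmap T U (f : T -> U) (m : dist R T) F :
  expect (dmap f m) F = expect m (F \o f).
Proof. by rewrite /expect /dmap big_map. Qed.

Lemma expect_uniform T (s : seq T) (F : T -> R) :
  expect (uniform R s) F = (size s)%:R^-1 * \sum_(x <- s) F x.
Proof. by rewrite /expect /uniform big_map mulr_sumr. Qed.

Lemma pmf_expect (T : eqType) (m : dist R T) y :
  pmf m y = expect m (fun z => (z == y)%:R).
Proof.
by rewrite /pmf /expect big_mkcond; apply: eq_bigr => p _; case: eqP;
  rewrite ?mulr1 ?mulr0.
Qed.

Definition nonneg_dist T (m : dist R T) : bool := all (fun p => 0 <= p.1) m.

Lemma all_dbind T U (m : dist R T) (f : T -> dist R U) (P : pred (R * U)) :
  all P (dbind m f)
    = all (fun p => all (fun q => P (p.1 * q.1, q.2)) (f p.2)) m.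
Proof. by rewrite /dbind; elim: m => //= p m IHm; rewrite all_cat IHm all_map. Qed.

Lemma nonneg_dret T (x : T) : nonneg_dist (dret R x).
Proof. by rewrite /nonneg_dist /= ler01. Qed.

Lemma nonneg_dbind T U (m : dist R T) (f : T -> dist R U) :
  nonneg_dist m -> (forall x, nonneg_dist (f x)) -> nonneg_dist (dbind m f).
Proof.
move=> m_ge0 f_ge0; rewrite /nonneg_dist all_dbind.
by apply: sub_all m_ge0 => p p_ge0; apply: sub_all (f_ge0 p.2) => q; apply: mulr_ge0.
Qed.

Lemma nonneg_dfold I T (f : I -> T -> dist R T) r x :
  (forall i y, nonneg_dist (f i y)) -> nonneg_dist (dfold f r x).
Proof.
by move=> f_ge0; elim: r x => [|i r IHr] x; [exact: nonneg_dret | exact: nonneg_dbind].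
Qed.

Lemma expect_gt0 (T : eqType) (m : dist R T) (F : T -> R) w y :
    nonneg_dist m -> (forall x, 0 <= F x) -> (w, y) \in m -> 0 < w * F y ->
  0 < expect m F.
Proof.
move=> /allP m_ge0 F_ge0 wy wF; rewrite /expect (big_rem _ wy) /= ltr_pwDl //.
by rewrite big_seq sumr_ge0 // => p /mem_rem /m_ge0 p_ge0; apply: mulr_ge0.
Qed.

End Distributions.

Section Coupling.
Variable R : realFieldType.

(* The relation [rel] supports a coupling of [m] and [m']; phrased through
   expectations, this is insensitive to the order and the multiplicity of the
   outcomes in the lists. *)
Definition coupled T U (m : dist R T) (m' : dist R U) (rel : T -> U -> Prop) : Prop :=
  forall F G, (forall s t, rel s t -> F s = G t) -> expect m F = expect m' G.

Lemma coupled_dret T U (s : T) (t : U) (rel : T -> U -> Prop) :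
  rel s t -> coupled (dret R s) (dret R t) rel.
Proof. by move=> st F G FG; rewrite !expect_dret; apply: FG. Qed.

Lemma coupled_dbind T U T' U' (m : dist R T) (m' : dist R U)
    (f : T -> dist R T') (g : U -> dist R U') rel rel' :
    coupled m m' rel -> (forall s t, rel s t -> coupled (f s) (g t) rel') ->
  coupled (dbind m f) (dbind m' g) rel'.
Proof.
by move=> mm fg F G FG; rewrite !expect_dbind; apply: mm => s t st; apply: (fg s t st).
Qed.

Lemma coupled_dbindl T T' U (m : dist R T) (f : T -> dist R T') (m' : dist R U)
    rel (rel' : T' -> U -> Prop) :
    coupled m m' rel -> (forall s t, rel s t -> coupled (f s) (dret R t) rel') ->
  coupled (dbind m f) m' rel'.
Proof.
move=> mm fr F G FG; rewrite expect_dbind; apply: mm => s t st.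
by rewrite (fr s t st F G FG) expect_dret.
Qed.

Lemma coupled_mono T U (m : dist R T) (m' : dist R U) (rel rel' : T -> U -> Prop) :
  coupled m m' rel -> (forall s t, rel s t -> rel' s t) -> coupled m m' rel'.
Proof. by move=> mm rr F G FG; apply: mm => s t /rr; apply: FG. Qed.

Lemma coupled_pmf (T : Type) (U : eqType) (m : dist R T) (m' : dist R U) (f : T -> U) :
  coupled m m' (fun s t => f s = t) -> pmf (dmap f m) =1 pmf m'.
Proof.
by move=> mm y; rewrite !pmf_expect expect_dmap; apply: mm => s t /= ->.
Qed.

Lemma coupled_surely T U (V : eqType) (m : dist R T) (m' : dist R U) rel
    (f : T -> V) (P : pred V) :
    nonneg_dist m -> coupled m m' rel -> (forall s t, rel s t -> P (f s)) ->
  surely (dmap f m) P.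
Proof.
move=> m_ge0 mm relP w y wy w_gt0; apply/negPn/negP => notP.
pose F v : R := (~~ P v)%:R.
have : 0 < expect (dmap f m) F.
  apply: expect_gt0 wy _; rewrite /F ?notP ?mulr1 //.
  by rewrite /nonneg_dist all_map.
rewrite expect_dmap (mm _ (fun=> 0)) => [|s t /relP]; last by rewrite /= /F => ->.
by rewrite /expect big1 ?ltxx // => p _; rewrite mulr0.
Qed.

End Coupling.

(** * Costs of clusterings *)

Lemma sumr_const_seq (R : pzSemiRingType) (T : Type) (s : seq T) (u : R) :
  \sum_(x <- s) u = (size s)%:R * u.
Proof. by rewrite big_const_seq count_predT iter_addr addr0 mulr_natl. Qed.

Lemma sum_sqr_diff (R : comPzRingType) (T : Type) (A : seq T) (f : T -> R) :
  \sum_(x <- A) \sum_(y <- A) (f x - f y) ^+ 2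
    = 2 * (size A)%:R * \sum_(x <- A) f x ^+ 2 - 2 * (\sum_(x <- A) f x) ^+ 2.
Proof.
have sum_row u : \sum_(y <- A) (u - f y) ^+ 2
    = (size A)%:R * u ^+ 2 - 2 * u * \sum_(y <- A) f y + \sum_(y <- A) f y ^+ 2.
  under eq_bigr do rewrite sqrrB.
  rewrite !big_split /= sumr_const_seq mulr_sumr -sumrN.
  by congr (_ + _ + _); apply: eq_bigr => y _; ring.
under eq_bigr do rewrite sum_row.
rewrite !big_split /= sumrN sumr_const_seq -mulr_sumr -mulr_suml -mulr_sumr; ring.
Qed.

Lemma rcons_neq0 (T : eqType) (s : seq T) (x : T) : rcons s x != [::].
Proof. by rewrite -size_eq0 size_rcons. Qed.

Section SquaredDistance.
Variables (R : realFieldType) (d : nat).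
Implicit Types (x y z c : 'rV[R]_d) (A C X : seq 'rV[R]_d).

Lemma sqdist_ge0 x y : 0 <= sqdist x y.
Proof. by apply: sumr_ge0 => j _; apply: sqr_ge0. Qed.

Lemma sqdistC x y : sqdist x y = sqdist y x.
Proof. by apply: eq_bigr => j _; rewrite -opprB sqrrN. Qed.

Lemma sqdist_triangle x y z : sqdist x z <= 2 * sqdist x y + 2 * sqdist y z.
Proof.
rewrite /sqdist !mulr_sumr -big_split /=; apply: ler_sum => j _.
have := sqr_ge0 (x 0 j - y 0 j - (y 0 j - z 0 j)).
by move: (x 0 j) (y 0 j) (z 0 j) => a b c; rewrite !expr2; nra.
Qed.

Lemma sum_sqdist_pairs_le A c :
  \sum_(x <- A) \sum_(y <- A) sqdist x y
    <= 2 * (size A)%:R * \sum_(x <- A) sqdist x c.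
Proof.
under eq_bigr => x _ do rewrite /sqdist exchange_big.
rewrite exchange_big /= [X in _ <= _ * X]exchange_big /= mulr_sumr.
apply: ler_sum => j _.
have -> : \sum_(x <- A) \sum_(y <- A) (x 0 j - y 0 j) ^+ 2
    = \sum_(x <- A) \sum_(y <- A) (x 0 j - c 0 j - (y 0 j - c 0 j)) ^+ 2.
  by apply: eq_bigr => x _; apply: eq_bigr => y _; rewrite opprB addrA subrK.
by rewrite (sum_sqr_diff A (fun x => x 0 j - c 0 j)) gerBl mulr_ge0 ?sqr_ge0.
Qed.

Lemma mindist1 c x : mindist [:: c] x = sqdist x c.
Proof. by rewrite /mindist big_seq1_id /= minxx. Qed.

Lemma mindist_rcons C y x : C != [::] ->
  mindist (rcons C y) x = Order.min (mindist C x) (sqdist x y).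
Proof.
case: C => // c C _; rewrite /mindist (perm_big _ (permEl (perm_rcons _ _))) /=.
by rewrite big_cons minC.
Qed.

Lemma mindist_le C c x : c \in C -> mindist C x <= sqdist x c.
Proof. by move=> cC; apply: ge_bigmin_seq. Qed.

Lemma mindist_attained C x : C != [::] -> exists2 c, c \in C & mindist C x = sqdist x c.
Proof.
move=> C_neq0; rewrite /mindist big_seq.
elim/big_ind: _ => [|_ _ [a aC ->] [b bC ->]|c cC].
- by exists (head 0 C) => //; case: C C_neq0 => // c C _; apply: mem_head.
- by case: leP => _; [exists a | exists b].
- by exists c.
Qed.

Lemma mindist_ge0 C x : C != [::] -> 0 <= mindist C x.
Proof. by move=> /(mindist_attained x) [c _ ->]; apply: sqdist_ge0. Qed.

Lemma mindist_triangle C x y : C != [::] ->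
  mindist C x <= 2 * mindist C y + 2 * sqdist x y.
Proof.
move=> /(mindist_attained y) [c cC ->]; apply: le_trans (mindist_le x cC) _.
by rewrite addrC; apply: sqdist_triangle.
Qed.

Lemma Phi_ge0 C X : C != [::] -> 0 <= Phi C X.
Proof. by move=> C_neq0; apply: sumr_ge0 => x _; apply: mindist_ge0. Qed.

Lemma Phi1 c X : Phi [:: c] X = \sum_(x <- X) sqdist x c.
Proof. by apply: eq_bigr => x _; rewrite mindist1. Qed.

Lemma Phi_rcons_le C y X : C != [::] -> Phi (rcons C y) X <= Phi C X.
Proof.
by move=> C_neq0; apply: ler_sum => x _; rewrite mindist_rcons // ge_min lexx.
Qed.

Lemma Phi_rcons_le_sqdist C y X : Phi (rcons C y) X <= \sum_(x <- X) sqdist x y.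
Proof. by apply: ler_sum => x _; apply: mindist_le; rewrite mem_rcons mem_head. Qed.

Lemma size_mindist_le A C y : C != [::] ->
  (size A)%:R * mindist C y <= 2 * Phi C A + 2 * \sum_(a <- A) sqdist y a.
Proof.
move=> C_neq0; rewrite -sumr_const_seq /Phi !mulr_sumr -big_split /=.
by apply: ler_sum => a _; apply: mindist_triangle.
Qed.

Lemma expect_D2_sample X C (F : 'rV[R]_d -> R) : Phi C X != 0 ->
  expect (D2_sample X C) F = (Phi C X)^-1 * \sum_(x <- X) mindist C x * F x.
Proof.
move=> /negbTE Phi_neq0; rewrite /expect /D2_sample Phi_neq0 big_map mulr_sumr.
by apply: eq_bigr => x _; rewrite /= /Phi big_seq1 mulrAC mulrA mulrC mulrA.
Qed.

Lemma expect_D2_sample_le X C (F : 'rV[R]_d -> R) (b : R) :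
    X != [::] -> C != [::] -> (forall x, F x <= b) ->
  expect (D2_sample X C) F <= b.
Proof.
move=> X_neq0 C_neq0 F_le; have [Phi0|Phi_neq0] := eqVneq (Phi C X) 0.
  rewrite /D2_sample Phi0 eqxx expect_uniform.
  rewrite ler_pdivrMl ?ltr0n ?lt0n ?size_eq0 // -sumr_const_seq.
  by apply: ler_sum => x _.
rewrite expect_D2_sample // ler_pdivrMl ?lt_def ?Phi_neq0 ?Phi_ge0 // mulr_suml.
by apply: ler_sum => x _; rewrite ler_wpM2l ?mindist_ge0.
Qed.

End SquaredDistance.

Section ClusterCost.
Variables (R : realType) (d : nat).
Implicit Types (x y c : 'rV[R]_d) (A C : seq 'rV[R]_d).

Lemma le_Delta1 A (u : R) :
  (forall c, u <= \sum_(x <- A) sqdist x c) -> u <= Delta 1 A.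
Proof.
move=> u_le; apply: lb_le_inf.
  by exists (Phi [:: 0] A); exists [:: 0].
by move=> _ [C [_ /= sC] <-]; case: C sC => [|c []] // _; rewrite Phi1.
Qed.

Lemma Delta1_ge0 A : 0 <= Delta 1 A.
Proof. by apply: le_Delta1 => c; apply: sumr_ge0 => x _; apply: sqdist_ge0. Qed.

Lemma sum_sqdist_Delta1_le A :
  \sum_(x <- A) \sum_(y <- A) sqdist x y <= 2 * (size A)%:R * Delta 1 A.
Proof.
case: (posnP (size A)) => [/size0nil -> | A_gt0]; first by rewrite big_nil mulr0 mul0r.
have size_gt0 : 0 < 2 * (size A)%:R :> R by rewrite mulr_gt0 ?ltr0n.
rewrite -ler_pdivrMl //; apply: le_Delta1 => c.
by rewrite ler_pdivrMl //; apply: sum_sqdist_pairs_le.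
Qed.

Lemma D2_cluster_cost_le A C : C != [::] ->
  \sum_(y <- A) mindist C y * Phi (rcons C y) A <= 8 * Delta 1 A * Phi C A.
Proof.
move=> C_neq0; case: (posnP (size A)) => [/size0nil -> | A_gt0].
  by rewrite /Phi !big_nil mulr0.
have size_gt0 : 0 < (size A)%:R :> R by rewrite ltr0n.
have Phi_C_ge0 := Phi_ge0 A C_neq0.
rewrite -(ler_pM2l size_gt0) mulr_sumr.
apply: (@le_trans _ _ (\sum_(y <- A) 4 * Phi C A * \sum_(a <- A) sqdist y a)).
  apply: ler_sum => y _; set D := \sum_(a <- A) _.
  have D_ge0 : 0 <= D by apply: sumr_ge0 => a _; apply: sqdist_ge0.
  have Phi_ge0 : 0 <= Phi (rcons C y) A by apply/Phi_ge0/rcons_neq0.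
  have Phi_le_C := Phi_rcons_le y A C_neq0.
  have Phi_le_D : Phi (rcons C y) A <= D.
    apply: le_trans (Phi_rcons_le_sqdist _ _ _) _.
    by apply: ler_sum => a _; rewrite sqdistC.
  (* The new cost is bounded by [D] against the first term of
     [size_mindist_le] and by [Phi C A] against the second. *)
  rewrite mulrA; apply: le_trans (ler_wpM2r Phi_ge0 (size_mindist_le _ _ C_neq0)) _.
  rewrite -/D; nra.
rewrite -mulr_sumr; apply: le_trans (ler_wpM2l _ (sum_sqdist_Delta1_le A)) _.
  by rewrite mulr_ge0.
lra.
Qed.

End ClusterCost.

(** * Approximation ratio *)

Lemma geometric_failure_le (R : realFieldType) (r : R) m :
  0 <= r -> 2 * r <= 1 -> (2 ^+ m - 1) * r ^+ m * (1 - r) <= r * (1 - r ^+ m).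
Proof.
move=> r_ge0 r_le; elim: m => [|m IHm]; first by rewrite !expr0 subrr !(mul0r, mulr0).
have rm_ge0 : 0 <= r ^+ m by rewrite exprn_ge0.
have rm_le1 : r ^+ m <= 1 by rewrite exprn_ile1 //; lra.
have : 2 * r * ((2 ^+ m - 1) * r ^+ m * (1 - r)) <= r * (1 - r ^+ m).
  apply: (le_trans (ler_wpM2l _ IHm)); first by rewrite mulr_ge0.
  by rewrite ler_piMl // mulr_ge0 // subr_ge0.
rewrite !exprS; lra.
Qed.

Definition covered (T : Type) (k : nat) (cl : T -> 'I_k) (C : seq T) (i : 'I_k) : bool :=
  has (fun c => cl c == i) C.

Lemma covered1 T k (cl : T -> 'I_k) c i : covered cl [:: c] i = (i == cl c).
Proof. by rewrite /covered /= orbF eq_sym. Qed.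

Lemma covered_rcons T k (cl : T -> 'I_k) C x i :
  covered cl (rcons C x) i = (i == cl x) || covered cl C i.
Proof. by rewrite /covered has_rcons eq_sym. Qed.

Section ApproximationRatio.
Variables (R : realType) (d k : nat) (X : seq 'rV[R]_d) (cl : 'rV[R]_d -> 'I_k).
Hypothesis X_neq0 : X != [::].
Implicit Types (x y c : 'rV[R]_d) (C : seq 'rV[R]_d) (i : 'I_k).

Definition missed C : {set 'I_k} := [set i | ~~ covered cl C i].

Definition cluster i : seq 'rV[R]_d := [seq x <- X | cl x == i].

Definition hit_cost C : R := \sum_(i | covered cl C i) Phi C (cluster i).

Definition missed_cost C : R := \sum_(i | ~~ covered cl C i) Phi C (cluster i).

(* The probability that a point that is D^2-sampled w.r.t. [C] lies in a cluster
   that [C] meets. *)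
Definition hit_prob C : R := hit_cost C / Phi C X.

Definition potential C : R :=
  hit_cost C + \sum_(i | ~~ covered cl C i) 8 * Delta 1 (cluster i).

Lemma sum_cluster (F : 'rV[R]_d -> R) (P : pred 'I_k) :
  \sum_(x <- X | P (cl x)) F x = \sum_(i | P i) \sum_(x <- cluster i) F x.
Proof.
rewrite (partition_big cl P) //; apply: eq_bigr => i Pi.
rewrite big_filter; apply: eq_bigl => x.
by case: eqP => [->|]; rewrite ?Pi ?andbF.
Qed.

Lemma sum_missed_mindist C :
  \sum_(x <- X | ~~ covered cl C (cl x)) mindist C x = missed_cost C.
Proof. exact: (sum_cluster _ (fun i => ~~ covered cl C i)). Qed.

Lemma Phi_hitD_missed C : Phi C X = hit_cost C + missed_cost C.
Proof.
rewrite /Phi (sum_cluster _ predT) /hit_cost /missed_cost.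
by rewrite (bigID (covered cl C)).
Qed.

Lemma hit_cost_ge0 C : C != [::] -> 0 <= hit_cost C.
Proof. by move=> C_neq0; apply: sumr_ge0 => i _; apply: Phi_ge0. Qed.

Lemma missed_cost_ge0 C : C != [::] -> 0 <= missed_cost C.
Proof. by move=> C_neq0; apply: sumr_ge0 => i _; apply: Phi_ge0. Qed.

Lemma hit_cost_le_potential C : hit_cost C <= potential C.
Proof.
by rewrite lerDl; apply: sumr_ge0 => i _; rewrite mulr_ge0 // Delta1_ge0.
Qed.

Lemma potential_ge0 C : C != [::] -> 0 <= potential C.
Proof. by move=> /hit_cost_ge0 /le_trans; apply; apply: hit_cost_le_potential. Qed.

Lemma hit_prob_ge0 C : C != [::] -> 0 <= hit_prob C.
Proof. by move=> C_neq0; rewrite divr_ge0 ?hit_cost_ge0 ?Phi_ge0. Qed.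

Lemma hit_cost_prob C : Phi C X != 0 -> hit_cost C = hit_prob C * Phi C X.
Proof. by move=> Phi_neq0; rewrite divfK. Qed.

Lemma missed_cost_prob C : Phi C X != 0 ->
  missed_cost C = (1 - hit_prob C) * Phi C X.
Proof.
by move=> /hit_cost_prob hitE; have := Phi_hitD_missed C; rewrite {1}hitE; lra.
Qed.

Lemma sum_missed_rcons C x (F : 'I_k -> R) : ~~ covered cl C (cl x) ->
  \sum_(i | ~~ covered cl C i) F i
    = F (cl x) + \sum_(i | ~~ covered cl (rcons C x) i) F i.
Proof.
move=> x_missed; rewrite (bigD1 (cl x)) //=; congr (_ + _); apply: eq_bigl => i.
by rewrite covered_rcons negb_or andbC.
Qed.

Lemma sum_covered_rcons C x (F : 'I_k -> R) : ~~ covered cl C (cl x) ->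
  \sum_(i | covered cl (rcons C x) i) F i = F (cl x) + \sum_(i | covered cl C i) F i.
Proof.
move=> x_missed; rewrite (bigD1 (cl x)) /=; last by rewrite covered_rcons eqxx.
congr (_ + _); apply: eq_bigl => i; rewrite covered_rcons.
by case: eqP => [->|] //=; rewrite ?andbT // (negbTE x_missed).
Qed.

Lemma card_missed_rcons C x : ~~ covered cl C (cl x) ->
  #|missed C| = #|missed (rcons C x)|.+1.
Proof.
move=> x_missed; rewrite (cardsD1 (cl x)) inE x_missed add1n; congr _.+1.
by apply: eq_card => i; rewrite !inE covered_rcons negb_or.
Qed.

Lemma card_missed1 c : #|missed [:: c]| = k.-1.
Proof.
rewrite -[k in RHS](card_ord k) -cardsT (cardsD1 (cl c)) inE add1n.
by apply: eq_card => i; rewrite !inE covered1 andbT.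
Qed.

Lemma missed_cost0 C : (#|missed C| <= 0)%N -> missed_cost C = 0.
Proof.
rewrite leqn0 cards_eq0 => /eqP /setP missed0; apply: big_pred0 => i.
by have := missed0 i; rewrite !inE.
Qed.

Lemma missed_cost_rcons_le C x : C != [::] -> ~~ covered cl C (cl x) ->
  missed_cost (rcons C x) <= missed_cost C.
Proof.
move=> C_neq0 x_missed; rewrite [leRHS](sum_missed_rcons _ x_missed).
by rewrite ler_wpDl ?Phi_ge0 //; apply: ler_sum => i _; apply: Phi_rcons_le.
Qed.

Lemma potential_rcons_le C x : C != [::] -> ~~ covered cl C (cl x) ->
  potential (rcons C x) <= potential C
    + (Phi (rcons C x) (cluster (cl x)) - 8 * Delta 1 (cluster (cl x))).
Proof.
move=> C_neq0 x_missed; rewrite /potential (sum_missed_rcons _ x_missed).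
rewrite {1}/hit_cost (sum_covered_rcons _ x_missed).
have : \sum_(i | covered cl C i) Phi (rcons C x) (cluster i) <= hit_cost C.
  by apply: ler_sum => i _; apply: Phi_rcons_le.
lra.
Qed.

Lemma D2_potential_le C : C != [::] ->
  \sum_(x <- X | ~~ covered cl C (cl x)) mindist C x * potential (rcons C x)
    <= missed_cost C * potential C.
Proof.
move=> C_neq0.
pose excess i x := Phi (rcons C x) (cluster i) - 8 * Delta 1 (cluster i).
apply: (@le_trans _ _ (\sum_(x <- X | ~~ covered cl C (cl x))
   (mindist C x * potential C + mindist C x * excess (cl x) x))).
  apply: ler_sum => x x_missed; rewrite -mulrDr ler_wpM2l ?mindist_ge0 //.
  exact: potential_rcons_le.
rewrite big_split /= -mulr_suml sum_missed_mindist gerDl.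
rewrite (sum_cluster (fun x => mindist C x * excess (cl x) x)
          (fun i => ~~ covered cl C i)).
apply: sumr_le0 => i _; rewrite /cluster big_filter.
under eq_bigr => x /eqP -> do rewrite mulrBr.
rewrite -big_filter sumrB -mulr_suml subr_le0 [leRHS]mulrC.
exact: D2_cluster_cost_le.
Qed.

Lemma D2_affine_potential_le C (b e : R) (F : 'rV[R]_d -> R) : C != [::] -> 0 <= b ->
    (forall x, ~~ covered cl C (cl x) -> F x <= b * potential (rcons C x) + e) ->
  \sum_(x <- X | ~~ covered cl C (cl x)) mindist C x * F x
    <= missed_cost C * (b * potential C + e).
Proof.
move=> C_neq0 b_ge0 F_le.
apply: (@le_trans _ _ (b * \sum_(x <- X | ~~ covered cl C (cl x))
    mindist C x * potential (rcons C x)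
    + \sum_(x <- X | ~~ covered cl C (cl x)) mindist C x * e)).
  rewrite mulr_sumr -big_split /=; apply: ler_sum => x x_missed.
  by rewrite mulrCA -mulrDr ler_wpM2l ?mindist_ge0 // F_le.
rewrite -mulr_suml sum_missed_mindist.
have := ler_wpM2l b_ge0 (D2_potential_le C_neq0); lra.
Qed.

Section InnerLoop.
Variables (C : seq 'rV[R]_d) (F : seq 'rV[R]_d * nat -> R).
Hypothesis C_neq0 : C != [::].

Lemma expect_inner_loop_le m q (success failure : R) : Phi C X != 0 ->
    (forall q', \sum_(x <- X | ~~ covered cl C (cl x)) mindist C x * F (rcons C x, q')
       <= missed_cost C * success) ->
    (forall q', F (C, q') <= failure) ->
  expect (inner_loop X cl m (C, q)) F
    <= (1 - hit_prob C ^+ m) * success + hit_prob C ^+ m * failure.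
Proof.
move=> Phi_neq0 F_rcons F_same; set r := hit_prob C.
elim: m q => [|m IHm] q /=.
  by rewrite expect_dret expr0 subrr mul0r mul1r add0r.
rewrite expect_dbind expect_D2_sample //.
rewrite ler_pdivrMl ?lt_def ?Phi_neq0 ?Phi_ge0 //.
rewrite (bigID (fun x => covered cl C (cl x))) /=.
set bound := (1 - r ^+ m) * success + r ^+ m * failure in IHm.
apply: (@le_trans _ _ (hit_cost C * bound + missed_cost C * success)).
  apply: lerD.
    rewrite /hit_cost -sum_cluster mulr_suml; apply: ler_sum => x x_covered.
    by rewrite ifT // ler_wpM2l ?mindist_ge0.
  under eq_bigr => x x_missed do rewrite (ifN _ _ x_missed) expect_dret.
  exact: F_rcons.
rewrite hit_cost_prob // missed_cost_prob // /bound exprS -/r; lra.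
Qed.

Lemma expect_inner_loop_bounded m q (b : R) :
    (forall x q', F (rcons C x, q') <= b) -> (forall q', F (C, q') <= b) ->
  expect (inner_loop X cl m (C, q)) F <= b.
Proof.
move=> F_rcons F_same; elim: m q => [|m IHm] q /=; first by rewrite expect_dret.
rewrite expect_dbind; apply: expect_D2_sample_le => // x.
by case: ifP => _; rewrite ?expect_dret.
Qed.

End InnerLoop.

Definition final_cost m C q : R :=
  expect (outer_loop X cl m (C, q)) (fun o => Phi o.1 X).

Lemma final_cost0 C q : final_cost 0 C q = Phi C X.
Proof. exact: expect_dret. Qed.

Lemma final_costS m C q : final_cost m.+1 C q
  = expect (inner_loop X cl (up_log 2 k) (C, q)) (fun o => final_cost m o.1 o.2).
Proof. by rewrite /final_cost /= expect_dbind; apply: eq_bigr => -[w [? ?]] _. Qed.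

Lemma final_cost_le_Phi m C q : C != [::] -> final_cost m C q <= Phi C X.
Proof.
elim: m C q => [|m IHm] C q C_neq0; first by rewrite final_cost0.
rewrite final_costS; apply: expect_inner_loop_bounded => //= [x q'|q']; last exact: IHm.
by apply: le_trans (IHm _ _ (rcons_neq0 C x)) _; apply: Phi_rcons_le.
Qed.

Lemma final_cost_le_missed m C q : C != [::] ->
  final_cost m C q <= potential C + missed_cost C.
Proof.
elim: m C q => [|m IHm] C q C_neq0.
  by rewrite final_cost0 Phi_hitD_missed lerD2r hit_cost_le_potential.
have [Phi0|Phi_neq0] := eqVneq (Phi C X) 0.
  apply: le_trans (final_cost_le_Phi _ _ C_neq0) _.
  by rewrite Phi0 addr_ge0 ?potential_ge0 ?missed_cost_ge0.
rewrite final_costS.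
have success q' : \sum_(x <- X | ~~ covered cl C (cl x))
      mindist C x * final_cost m (rcons C x) q'
    <= missed_cost C * (1 * potential C + missed_cost C).
  apply: D2_affine_potential_le => // x x_missed; rewrite mul1r.
  apply: le_trans (IHm _ _ (rcons_neq0 C x)) _.
  by rewrite lerD2l missed_cost_rcons_le.
have failure q' : final_cost m C q' <= potential C + missed_cost C by apply: IHm.
rewrite mul1r in success.
apply: le_trans (expect_inner_loop_le C_neq0 _ _ Phi_neq0 success failure) _.
by rewrite -mulrDl subrK mul1r.
Qed.

Lemma failure_cost_le C : C != [::] -> (1 < k)%N -> hit_cost C < missed_cost C ->
  k.-1%:R * (hit_prob C ^+ up_log 2 k * missed_cost C) <= hit_cost C.
Proof.
move=> C_neq0 k_gt1 hit_lt; have hit_ge0 := hit_cost_ge0 C_neq0.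
have Phi_gt0 : 0 < Phi C X by have := Phi_hitD_missed C; lra.
have hitE := hit_cost_prob (lt0r_neq0 Phi_gt0).
have missedE := missed_cost_prob (lt0r_neq0 Phi_gt0).
have r_ge0 := hit_prob_ge0 C_neq0.
have r_le : 2 * hit_prob C <= 1.
  by rewrite -(ler_pM2r Phi_gt0); move: hit_lt; rewrite missedE {1}hitE; lra.
have k_le : k.-1%:R <= 2 ^+ up_log 2 k - 1 :> R.
  rewrite lerBrDr natr1 prednK ?(ltnW k_gt1) //.
  by rewrite -natrX ler_nat up_logP.
rewrite missedE hitE !mulrA ler_pM2r //.
move: (up_log 2 k) k_le => L k_le.
apply: le_trans (le_trans (geometric_failure_le L r_ge0 r_le) _); last first.
  by rewrite ler_piMr // gerBl exprn_ge0.
by rewrite !ler_wpM2r ?exprn_ge0 //; lra.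
Qed.

Lemma final_cost_le_potential m C q :
    C != [::] -> (1 < k)%N -> (#|missed C| <= m)%N ->
  final_cost m C q <= (2 + m%:R / k.-1%:R) * potential C.
Proof.
move=> + k_gt1; have pred_k_gt0 : 0 < k.-1%:R :> R.
  by rewrite ltr0n -ltnS (ltn_predK k_gt1).
elim: m C q => [|m IHm] C q C_neq0 card_le.
  rewrite final_cost0 mul0r addr0 Phi_hitD_missed missed_cost0 //.
  by have := hit_cost_le_potential C; have := potential_ge0 C_neq0; lra.
have hit_ge0 := hit_cost_ge0 C_neq0; have hit_le := hit_cost_le_potential C.
have kV_ge0 : 0 <= k.-1%:R^-1 :> R by rewrite invr_ge0 ltW.
set coef := 2 + m%:R / _ in IHm *.
have coef_ge2 : 2 <= coef by rewrite lerDl mulr_ge0.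
have -> : 2 + m.+1%:R / k.-1%:R = coef + k.-1%:R^-1.
  by rewrite /coef -[m.+1%:R]natr1 mulrDl mul1r addrA.
have [missed_le|hit_lt] := leP (missed_cost C) (hit_cost C).
  apply: le_trans (final_cost_le_missed _ _ C_neq0) _; nra.
have Phi_neq0 : Phi C X != 0 by have := Phi_hitD_missed C; lra.
rewrite final_costS.
have success q' : \sum_(x <- X | ~~ covered cl C (cl x))
      mindist C x * final_cost m (rcons C x) q'
    <= missed_cost C * (coef * potential C + 0).
  apply: D2_affine_potential_le => //; first lra.
  move=> x x_missed; rewrite addr0; apply: IHm; rewrite ?rcons_neq0 //.
  by rewrite -ltnS -card_missed_rcons.
have failure q' := final_cost_le_missed m q' C_neq0.
apply: le_trans (expect_inner_loop_le C_neq0 _ _ Phi_neq0 success failure) _.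
have := failure_cost_le C_neq0 k_gt1 hit_lt.
rewrite mulrC -ler_pdivlMr // mulrC.
have : 0 <= hit_prob C ^+ up_log 2 k by rewrite exprn_ge0 ?hit_prob_ge0.
set p := hit_prob C ^+ _ => p_ge0 failure_le.
have loss_le := ler_wpM2l kV_ge0 hit_le.
have : 0 <= p * ((coef - 1) * potential C).
  by rewrite !mulr_ge0 //; lra.
lra.
Qed.

Lemma potential1 x :
  potential [:: x] = 8 * (\sum_i Delta 1 (cluster i))
    + (Phi [:: x] (cluster (cl x)) - 8 * Delta 1 (cluster (cl x))).
Proof.
rewrite /potential /hit_cost (eq_bigl _ _ (covered1 cl x)) big_pred1_eq.
rewrite (eq_bigl _ _ (fun i => congr1 negb (covered1 cl x i))).
by rewrite -mulr_sumr [in RHS](bigD1 (cl x)) //=; ring.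
Qed.

Lemma sum_potential1_le :
  \sum_(x <- X) potential [:: x] <= (size X)%:R * (8 * \sum_i Delta 1 (cluster i)).
Proof.
under eq_bigr do rewrite potential1.
rewrite big_split /= sumr_const_seq gerDl.
pose excess i x := Phi [:: x] (cluster i) - 8 * Delta 1 (cluster i).
rewrite (sum_cluster (fun x => excess (cl x) x) predT); apply: sumr_le0 => i _.
rewrite {1}/cluster big_filter; under eq_bigr => x /eqP -> do rewrite /excess Phi1.
rewrite -big_filter -/(cluster i) sumrB subr_le0 sumr_const_seq exchange_big /=.
apply: le_trans (sum_sqdist_Delta1_le _) _.
by rewrite -mulrA [leLHS]mulrCA ler_wpM2l // ler_wpM2r ?Delta1_ge0 ?ler_nat.
Qed.

Lemma query_kmeanspp_cost_le : (1 < k)%N ->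
  expect (query_kmeanspp X cl) (fun o => Phi o.1 X)
    <= 24 * \sum_i Delta 1 (cluster i).
Proof.
move=> k_gt1; rewrite /query_kmeanspp expect_dbind expect_uniform.
rewrite ler_pdivrMl ?ltr0n ?lt0n ?size_eq0 //.
apply: (@le_trans _ _ (\sum_(x <- X) 3 * potential [:: x])); last first.
  by rewrite -mulr_sumr; have := sum_potential1_le; lra.
apply: ler_sum => x _; have pred_k_neq0 : k.-1%:R != 0 :> R.
  by rewrite pnatr_eq0 -lt0n -ltnS (ltn_predK k_gt1).
have := @final_cost_le_potential k.-1 [:: x] 0%N isT k_gt1.
by rewrite card_missed1 divff // (_ : 2 + 1 = 3 :> R); [apply | ring].
Qed.

End ApproximationRatio.
(** * Deterministic commands *)

Local Arguments exec : simpl never.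

Fixpoint deterministic (c : cmd) : bool :=
  match c with
  | Seq c1 c2 | If _ c1 c2 => deterministic c1 && deterministic c2
  | For _ _ c1 => deterministic c1
  | Flip _ _ | Rand _ _ => false
  | _ => true
  end.

Section Run.
Variables (R : realFieldType) (same : rel nat).
Implicit Types (s : state R) (c : cmd).

(* Meaningful for deterministic commands only. *)
Fixpoint run c s : state R :=
  match c with
  | Skip => tick 1 s
  | NSet a i e => tick (ncost i + ncost e).+1 (nset a (neval s i) (neval s e) s)
  | RSet a i e => tick (ncost i + rcost e).+1 (rset a (neval s i) (reval s e) s)
  | Seq c1 c2 => run c2 (run c1 s)
  | If b c1 c2 =>
      let s' := tick (bcost b).+1 s in if beval s b then run c1 s' else run c2 s'
  | For a e c1 =>
      foldl (fun s' i => run c1 (tick 1 (nset a 0 i s'))) (tick (ncost e).+1 s)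
        (iota 0 (neval s e))
  | Query a e1 e2 =>
      count_query (tick (ncost e1 + ncost e2).+1
        (nset a 0 (same (neval s e1) (neval s e2)) s))
  | Flip _ _ | Rand _ _ => s
  end.

Notation exec := (@exec R same).

Lemma exec_seq c1 c2 s : exec (Seq c1 c2) s = dbind (exec c1 s) (exec c2).
Proof. by []. Qed.

Lemma exec_if b c1 c2 s :
  exec (If b c1 c2) s = exec (if beval s b then c1 else c2) (tick (bcost b).+1 s).
Proof. by []. Qed.

Lemma exec_for a e c s :
  exec (For a e c) s = dfold (fun i s' => exec c (tick 1 (nset a 0 i s')))
    (iota 0 (neval s e)) (tick (ncost e).+1 s).
Proof.
rewrite [LHS](foldl_dbind (fun i s' => exec c (tick 1 (nset a 0 i s')))).
exact: dbind_dret.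
Qed.

Lemma exec_run c s : deterministic c -> exec c s = dret R (run c s).
Proof.
elim: c s => [|a i e|a i e|c1 IH1 c2 IH2|b c1 IH1 c2 IH2|a e c IH|||] //= s.
- by case/andP=> det1 det2; rewrite exec_seq IH1 // dbind_dret IH2.
- by case/andP=> det1 det2; rewrite exec_if; case: ifP => _; [apply: IH1 | apply: IH2].
- move=> det; rewrite exec_for; elim: (iota _ _) (tick _ _) => //= i r IHr s'.
  by rewrite IH // dbind_dret IHr.
Qed.

Lemma exec_seq_run c1 c2 s :
  deterministic c1 -> exec (Seq c1 c2) s = exec c2 (run c1 s).
Proof. by move=> det1; rewrite exec_seq exec_run // dbind_dret. Qed.

Lemma nonneg_exec c s : nonneg_dist (exec c s).
Proof.
elim: c s => [|a i e|a i e|c1 IH1 c2 IH2|b c1 IH1 c2 IH2|a e c IH|a e|a e|a e1 e2] s;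
  try exact: nonneg_dret.
- exact: nonneg_dbind.
- by rewrite exec_if; case: (beval s b).
- by rewrite exec_for; apply: nonneg_dfold.
- rewrite /nonneg_dist /= le_max lexx /= subr_ge0 ge_max ler01.
  by rewrite ge_min lexx.
- by rewrite /nonneg_dist !all_map; apply/allP => i _ /=; rewrite invr_ge0.
Qed.

Lemma expect_flip a e s (F : state R -> R) : 0 <= reval s e <= 1 ->
  expect (exec (Flip a e) s) F
    = reval s e * F (nset a 0 1 (tick (rcost e).+1 s))
      + (1 - reval s e) * F (nset a 0 0 (tick (rcost e).+1 s)).
Proof.
by case/andP=> p_ge0 p_le1; rewrite /expect big_cons big_seq1 /= min_r // max_r.
Qed.

Lemma run_skip s : run Skip s = tick 1 s.
Proof. by []. Qed.

Lemma run_nset a i e s :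
  run (NSet a i e) s = tick (ncost i + ncost e).+1 (nset a (neval s i) (neval s e) s).
Proof. by []. Qed.

Lemma run_rset a i e s :
  run (RSet a i e) s = tick (ncost i + rcost e).+1 (rset a (neval s i) (reval s e) s).
Proof. by []. Qed.

Lemma run_query a e1 e2 s :
  run (Query a e1 e2) s = count_query (tick (ncost e1 + ncost e2).+1
    (nset a 0 (same (neval s e1) (neval s e2)) s)).
Proof. by []. Qed.

Lemma run_if b c1 c2 s :
  run (If b c1 c2) s = run (if beval s b then c1 else c2) (tick (bcost b).+1 s).
Proof. by rewrite /=; case: ifP. Qed.

Lemma run_seq c1 c2 s : run (Seq c1 c2) s = run c2 (run c1 s).
Proof. by []. Qed.

Definition runE := (run_seq, run_nset, run_rset, run_query, run_skip).

Lemma run_for (I : nat -> state R -> Prop) a e c s n :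
    neval s e = n -> I 0%N (tick (ncost e).+1 s) ->
    (forall i s', (i < n)%N -> I i s' -> I i.+1 (run c (tick 1 (nset a 0 i s')))) ->
  I n (run (For a e c) s).
Proof.
move=> eE I0 IS; rewrite /= eE; set s0 := tick _ s in I0 *.
have loop m i s' : (i + m)%N = n -> I i s' ->
    I n (foldl (fun s' i => run c (tick 1 (nset a 0 i s'))) s' (iota i m)).
  elim: m i s' => [|m IHm] i s' /= im Ii; first by rewrite -im addn0.
  by apply: IHm; rewrite ?addSnnS //; apply: IS => //; rewrite -im; lia.
exact: loop.
Qed.

End Run.

Local Arguments run : simpl never.

Section Modifies.
Variable R : realFieldType.
Implicit Types (s : state R) (ns rs : seq nat).

Definition modifies ns rs (q t : nat) s s' : Prop :=
  [/\ forall a i, a \notin ns -> nmem s' a i = nmem s a i,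
      forall a i, a \notin rs -> rmem s' a i = rmem s a i,
      queries s' = (queries s + q)%N
    & (time s' <= time s + t)%N].

Section Projections.
Variables (ns rs : seq nat) (q t : nat) (s s' : state R).
Hypothesis mod_s : modifies ns rs q t s s'.

Lemma modifies_nmem a i : a \notin ns -> nmem s' a i = nmem s a i.
Proof. by case: mod_s => nE _ _ _; apply: nE. Qed.

Lemma modifies_rmem a i : a \notin rs -> rmem s' a i = rmem s a i.
Proof. by case: mod_s => _ rE _ _; apply: rE. Qed.

Lemma modifies_queries : queries s' = (queries s + q)%N.
Proof. by case: mod_s. Qed.

Lemma modifies_time : (time s' <= time s + t)%N.
Proof. by case: mod_s. Qed.

End Projections.

Lemma modifies_refl ns rs s : modifies ns rs 0 0 s s.
Proof. by split; rewrite ?addn0. Qed.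

Lemma modifies_trans ns rs q1 q2 t1 t2 s1 s2 s3 :
    modifies ns rs q1 t1 s1 s2 -> modifies ns rs q2 t2 s2 s3 ->
  modifies ns rs (q1 + q2) (t1 + t2) s1 s3.
Proof.
move=> [n12 r12 qu12 ti12] [n23 r23 qu23 ti23].
by split=> [a i ai|a i ai||]; rewrite ?n23 ?r23 ?n12 ?r12 ?qu23 ?qu12 ?addnA //; lia.
Qed.

Lemma modifies_sub ns rs ns' rs' q t s s' :
    modifies ns rs q t s s' -> all (mem ns') ns -> all (mem rs') rs ->
  modifies ns' rs' q t s s'.
Proof.
move=> [nE rE qE tE] /allP nn /allP rr; split=> // [a i ai|a i ai].
- by apply: nE; apply: contra ai => /nn.
- by apply: rE; apply: contra ai => /rr.
Qed.

Lemma modifies_leq ns rs q q' t t' s s' : q = q' -> (t <= t')%N ->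
  modifies ns rs q t s s' -> modifies ns rs q' t' s s'.
Proof. by move=> <- le_t [nE rE qE tE]; split=> //; lia. Qed.

Lemma upd_neq T (m : nat -> nat -> T) a b i j v : b != a -> upd m a i v b j = m b j.
Proof. by rewrite /upd => /negbTE ->. Qed.

Lemma modifies_nset ns rs q t a i v s s' :
  a \in ns -> modifies ns rs q t s s' -> modifies ns rs q t s (nset a i v s').
Proof.
move=> a_ns [nE rE qE tE]; split=> // b j b_ns.
by rewrite [LHS]upd_neq ?nE //; apply: contraNneq b_ns => ->.
Qed.

Lemma modifies_rset ns rs q t a i v s s' :
  a \in rs -> modifies ns rs q t s s' -> modifies ns rs q t s (rset a i v s').
Proof.
move=> a_rs [nE rE qE tE]; split=> // b j b_rs.
by rewrite [LHS]upd_neq ?rE //; apply: contraNneq b_rs => ->.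
Qed.

Lemma modifies_tick ns rs q t u s s' :
  modifies ns rs q t s s' -> modifies ns rs q (t + u) s (tick u s').
Proof. by move=> [nE rE qE tE]; split=> //=; lia. Qed.

Lemma modifies_count ns rs q t s s' :
  modifies ns rs q t s s' -> modifies ns rs q.+1 t s (count_query s').
Proof. by move=> [nE rE qE tE]; split=> //=; lia. Qed.

End Modifies.

Ltac solve_mem := rewrite /= ?inE ?eqxx ?orbT.

(* Retraces the steps that led to the final state. *)
Ltac chain_modifies :=
  repeat match goal with
  | |- modifies _ _ _ _ ?s ?s => eapply modifies_refl
  | |- modifies _ _ _ _ _ (tick _ _) => eapply modifies_tick
  | |- modifies _ _ _ _ _ (count_query _) => eapply modifies_count
  | |- modifies _ _ _ _ _ (nset _ _ _ _) => eapply modifies_nset; [by solve_mem |]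
  | |- modifies _ _ _ _ _ (rset _ _ _ _) => eapply modifies_rset; [by solve_mem |]
  | mod_s : modifies _ _ _ _ ?s ?s' |- modifies _ _ _ _ _ ?s' =>
      eapply modifies_trans; [| apply (modifies_sub mod_s); by solve_mem]
  | |- modifies _ _ _ _ _ ?s => unfold s
  end.

Ltac solve_modifies := eapply modifies_leq; [| | chain_modifies]; rewrite /=; lia.

(** * Subroutines of the program *)

Lemma up_log_leq p n e : (1 < p)%N -> (up_log p n <= e)%N = (n <= p ^ e)%N.
Proof.
move=> p_gt1; apply/idP/idP => [le_e|]; last exact: up_log_min.
by apply: leq_trans (up_logP n p_gt1) _; rewrite leq_exp2l.
Qed.

Section Subroutines.
Variables (R : realFieldType) (same : rel nat).
Notation run := (@run R same).
Implicit Types s : state R.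

Lemma ram_log_spec l v s : uniq [:: l; v; vPow; vI] ->
  let s' := run (ram_log l v) s in
  nmem s' l 0 = up_log 2 (nmem s v 0) /\
  modifies [:: l; vPow; vI] [::] 0 (50 * (nmem s v 0).+1) s s'.
Proof.
rewrite /= !inE !negb_or !andbT.
move=> /andP [/and3P [lv lPow lI] /andP [v_Pow v_I]].
set N := nmem s v 0; rewrite /ram_log !runE; set s0 := tick _ (nset vPow _ _ _).
pose I i s' := let e := minn i (up_log 2 N) in
  [/\ nmem s' l 0 = e, nmem s' vPow 0 = (2 ^ e)%N
    & modifies [:: l; vPow; vI] [::] 0 (20 + 40 * i) s s'].
set s1 := run (For _ _ _) s0; suff [lE _ mod_s1] : I N s1.
  split; last by solve_modifies.
  rewrite /= lE; apply/minn_idPr; rewrite up_log_leq //.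
  exact/ltnW/ltn_expl.
apply: run_for.
- by rewrite /= /upd (negbTE v_Pow) eq_sym (negbTE lv).
- rewrite /I /= min0n; split=> //; first by rewrite /= /upd (negbTE lPow) !eqxx.
  solve_modifies.
move=> i s' _ [lE powE mod_s']; rewrite run_if [beval _ _]/= /upd /= (negbTE v_I).
have -> : nmem s' v 0 = N.
  by rewrite (modifies_nmem mod_s') // !inE !negb_or eq_sym lv v_Pow v_I.
rewrite powE ltnNge -up_log_leq // -ltnNge gtn_min ltnn orbF.
case: ltnP => [lt_i|le_i]; rewrite !runE.
  rewrite /I (minn_idPl lt_i); rewrite (minn_idPl (ltnW lt_i)) in lE powE.
  split; last by solve_modifies.
  - by rewrite /= /upd /= !eqxx /= (negbTE lPow) (negbTE lI) /= lE addn1.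
  - rewrite /= /upd /= !eqxx /= [vPow == l]eq_sym (negbTE lPow) powE.
    by rewrite expnS mul2n addnn.
rewrite /I (minn_idPr (leqW le_i)); rewrite (minn_idPr le_i) in lE powE.
split; last by solve_modifies.
- by rewrite /= /upd (negbTE lI).
- by [].
Qed.

Lemma ram_check_spec s : let s' := run ram_check s in
  nmem s' vFound 0 = nat_of_bool (has (fun i => same (nmem s vCen i) (nmem s vX 0))
                                   (iota 0 (nmem s vNC 0))) /\
  modifies [:: vFound; vC; vAns] [::] (nmem s vNC 0) (50 * (nmem s vNC 0).+1) s s'.
Proof.
rewrite /= /ram_check !runE; set s0 := tick _ (nset vFound _ _ _).
pose found i := has (fun j => same (nmem s vCen j) (nmem s vX 0)) (iota 0 i).
pose I i s' := nmem s' vFound 0 = nat_of_bool (found i) /\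
  modifies [:: vFound; vC; vAns] [::] i (20 + 40 * i) s s'.
set s1 := run (For _ _ _) s0; suff [foundE mod_s1] : I (nmem s vNC 0) s1.
  by split; last by solve_modifies.
apply: run_for => //; first by split=> //; solve_modifies.
move=> i s' _ [foundE mod_s']; rewrite !runE; set s2 := count_query _.
have foundS : found i.+1 = found i || same (nmem s vCen i) (nmem s vX 0).
  by rewrite /found -addn1 iotaD has_cat /= orbF.
rewrite run_if [beval _ _]/= /upd /= !(modifies_nmem mod_s') // /I foundS.
by case: (same _ _); rewrite !runE ?orbT ?orbF; split=> //; solve_modifies.
Qed.

End Subroutines.
(** * The RAM implementation *)

Section Implementation.
Variables (R : realFieldType) (d k : nat) (X : seq 'rV[R]_d) (cl : 'rV[R]_d -> 'I_k).
Local Notation point i := (nth 0 X i).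
Local Notation same := (fun i j => cl (point i) == cl (point j)).
Local Notation exec := (@exec R same).
Local Notation run := (@run R same).
Local Notation n := (size X).
Implicit Types (s : state R) (C : seq 'rV[R]_d).

Definition data s : Prop :=
  [/\ nmem s vN 0 = n, nmem s vK 0 = k, nmem s vD 0 = d
    & forall i (j : 'I_d), rmem s aPt (i * d + j)%N = point i 0 j].

Definition costs C s : Prop :=
  (forall i, (i < n)%N -> rmem s aDist i = mindist C (point i)) /\
  (forall i, (i <= n)%N -> rmem s aSum i = \sum_(0 <= j < i) mindist C (point j)).

Lemma data_ram_input : data (ram_input k X).
Proof.
split=> // i j; have d_gt0 : (0 < d)%N by apply: leq_ltn_trans (ltn_ord j).
rewrite /= modnMDl modn_small // divnMDl // divn_small // addn0.
by rewrite insubT //= => jd; congr (point i 0 _); apply: val_inj.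
Qed.

Lemma data_modifies ns rs q t s s' : modifies ns rs q t s s' ->
  ~~ has (mem ns) [:: vN; vK; vD] -> aPt \notin rs -> data s -> data s'.
Proof.
move=> mod_s /=; rewrite orbF !negb_or => /and3P [nN nK nD] nP [sN sK sD sP].
by split=> [|||i j]; rewrite ?(modifies_nmem mod_s) ?(modifies_rmem mod_s).
Qed.

Lemma size_ram_output s : size (ram_output X s) = nmem s vNC 0.
Proof. by rewrite size_map size_iota. Qed.

Lemma ram_output_modifies ns rs q t s s' : modifies ns rs q t s s' ->
  vCen \notin ns -> vNC \notin ns -> ram_output X s' = ram_output X s.
Proof.
move=> mod_s nCen nNC; rewrite /ram_output (modifies_nmem mod_s) //.
by apply: eq_map => i; rewrite (modifies_nmem mod_s).
Qed.

Definition ram_distance : cmd :=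
  For vJ (nvar vD) (rassign aAcc (RAdd (rvar aAcc) (RMul ram_coord_diff ram_coord_diff))).

Definition ram_keep_closest : cmd :=
  If (NEq (nvar vNC) N1)
    (RSet aDist (nvar vI) (rvar aAcc))
    (If (RLt (rvar aAcc) (RGet aDist (nvar vI)))
      (RSet aDist (nvar vI) (rvar aAcc))
      Skip).

Definition ram_update_row : cmd := block [::
  rassign aAcc RZero;
  ram_distance;
  ram_keep_closest;
  RSet aSum (NAdd (nvar vI) N1) (RAdd (RGet aSum (nvar vI)) (RGet aDist (nvar vI)))].

Lemma ram_distance_spec s : data s -> rmem s aAcc 0 = 0 ->
  let s' := run ram_distance s in
  rmem s' aAcc 0 = sqdist (point (nmem s vI 0)) (point (nmem s vX 0)) /\
  modifies [:: vJ] [:: aAcc] 0 (10 + 50 * d) s s'.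
Proof.
move=> [_ _ sD sP] acc0 /=; set i := nmem s vI 0; set x := nmem s vX 0.
pose diff j := rmem s aPt (i * d + j)%N - rmem s aPt (x * d + j)%N.
pose I j s' := rmem s' aAcc 0 = \sum_(0 <= l < j) diff l * diff l /\
  modifies [:: vJ] [:: aAcc] 0 (10 + 50 * j) s s'.
set s' := run _ _; suff [accE mod_s'] : I d s'.
  split=> //; rewrite accE big_mkord; apply: eq_bigr => j _.
  by rewrite /diff !sP expr2.
apply: run_for => //; first by split; [rewrite big_nil | solve_modifies].
move=> j s1 _ [accE mod_s1]; split; last by rewrite !runE; solve_modifies.
rewrite runE big_nat_recr //= -accE /upd /=.
by rewrite !(modifies_nmem mod_s1) // !(modifies_rmem (a := aPt) mod_s1) // sD.
Qed.

Lemma ram_keep_closest_spec C y s : let i := nmem s vI 0 in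
    nmem s vNC 0 = (size C).+1 -> rmem s aAcc 0 = sqdist (point i) y ->
    (C != [::] -> rmem s aDist i = mindist C (point i)) ->
  let s' := run ram_keep_closest s in
  (forall j, rmem s' aDist j =
     if j == i then mindist (rcons C y) (point i) else rmem s aDist j) /\
  modifies [::] [:: aDist] 0 40 s s'.
Proof.
move=> i sNC accE distE; rewrite /= run_if [beval _ _]/= sNC eqSS size_eq0.
case: eqP => [->|/eqP C_neq0].
  rewrite !runE; split=> [j|]; last by solve_modifies.
  by rewrite /= /upd /= accE mindist1.
rewrite run_if [beval _ _]/= accE [rmem _ _ _](distE C_neq0) mindist_rcons //.
case: ltP => _; rewrite !runE; (split; last by solve_modifies) => j /=.
  by rewrite /upd /= accE.
by case: eqP => // ->; apply: distE.
Qed.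

Lemma ram_update_row_spec C s : let i := nmem s vI 0 in
    let new_dist := mindist (rcons C (point (nmem s vX 0))) (point i) in
    data s -> nmem s vNC 0 = (size C).+1 ->
    (C != [::] -> rmem s aDist i = mindist C (point i)) ->
  let s' := run ram_update_row s in
  [/\ forall j, rmem s' aDist j = if j == i then new_dist else rmem s aDist j,
      forall j, rmem s' aSum j =
        if j == i.+1 then rmem s aSum i + new_dist else rmem s aSum j
    & modifies [:: vJ] [:: aDist; aSum; aAcc] 0 (50 * d + 150) s s'].
Proof.
move=> i new_dist sdata sNC distE; rewrite /= /ram_update_row !runE.
set s1 := tick _ (rset _ _ _ _).
have mod_s1 : modifies [::] [:: aAcc] 0 10 s s1 by solve_modifies.
have data_s1 : data s1 by apply: data_modifies mod_s1 _ _ sdata.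
have [accE mod_s2] := ram_distance_spec data_s1 erefl.
set s2 := run _ s1 in accE mod_s2 *.
have mod_s02 : modifies [:: vJ] [:: aAcc] 0 (20 + 50 * d) s s2 by solve_modifies.
have i2 : nmem s2 vI 0 = i by apply: (modifies_nmem mod_s02).
have NC2 : nmem s2 vNC 0 = (size C).+1 by rewrite (modifies_nmem mod_s02).
have dist2 j : rmem s2 aDist j = rmem s aDist j by apply: (modifies_rmem mod_s02).
have distE2 : C != [::] ->
    rmem s2 aDist (nmem s2 vI 0) = mindist C (point (nmem s2 vI 0)).
  by rewrite dist2 i2.
have accE2 : rmem s2 aAcc 0 = sqdist (point (nmem s2 vI 0)) (point (nmem s vX 0)).
  by rewrite i2.
have [distE3 mod_s3] := ram_keep_closest_spec NC2 accE2 distE2.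
set s3 := run _ s2 in distE3 mod_s3 *; rewrite i2 -/new_dist in distE3.
have i3 : nmem s3 vI 0 = i by rewrite (modifies_nmem mod_s3).
have sum3 j : rmem s3 aSum j = rmem s aSum j.
  by rewrite (modifies_rmem mod_s3) // (modifies_rmem mod_s02).
split=> [j|j|]; last by solve_modifies.
- by rewrite /= -dist2 -distE3.
- by rewrite /= /upd /= i3 addn1 !sum3 distE3 eqxx.
Qed.

Lemma ram_update_rows_spec C s : let C' := rcons C (point (nmem s vX 0)) in
    data s -> nmem s vNC 0 = (size C).+1 -> rmem s aSum 0 = 0 ->
    (C != [::] -> forall i, (i < n)%N -> rmem s aDist i = mindist C (point i)) ->
  let s' := run (For vI (nvar vN) ram_update_row) s in
  costs C' s' /\
  modifies [:: vI; vJ] [:: aDist; aSum; aAcc] 0 (10 + n * (50 * d + 200)) s s'.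
Proof.
move=> C' sdata sNC sum0 distE /=; have [sN _ _ _] := sdata.
pose I i s' := [/\
  forall j, rmem s' aDist j = if (j < i)%N then mindist C' (point j) else rmem s aDist j,
  forall j, (j <= i)%N -> rmem s' aSum j = \sum_(0 <= l < j) mindist C' (point l)
  & modifies [:: vI; vJ] [:: aDist; aSum; aAcc] 0 (10 + i * (50 * d + 200)) s s'].
set s' := run _ s; suff [dist' sum' mod_s'] : I n s'.
  by split=> //; split=> // i lt_in; rewrite dist' lt_in.
apply: run_for => //.
  by split=> [//|j|]; [rewrite leqn0 => /eqP ->; rewrite big_nil | solve_modifies].
move=> i s1 lt_in [dist1 sum1 mod_s1]; set s2 := tick 1 _.
have mod_s2 : modifies [:: vI; vJ] [:: aDist; aSum; aAcc] 0
    (11 + i * (50 * d + 200)) s s2.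
  by solve_modifies.
have data2 : data s2 by apply: data_modifies mod_s2 _ _ sdata.
have NC2 : nmem s2 vNC 0 = (size C).+1 by rewrite (modifies_nmem mod_s2).
have x2 : nmem s2 vX 0 = nmem s vX 0 by rewrite (modifies_nmem mod_s2).
have dist2 : C != [::] -> rmem s2 aDist i = mindist C (point i).
  by move=> C_neq0; rewrite [LHS]dist1 ltnn distE.
have [dist3 sum3 mod_s3] := ram_update_row_spec data2 NC2 dist2.
rewrite x2 -/C' in dist3 sum3; split=> [j|j|].
- by rewrite dist3 [rmem s2 _ _]dist1 ltnS; case: (ltngtP j i) => [||->].
- rewrite sum3 leq_eqVlt ltnS; case: eqP => [-> _|_ /= le_ji]; last exact: sum1.
  by rewrite big_nat_recr //= -sum1.
- by rewrite mulSn; solve_modifies.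
Qed.

Definition add_time : nat := (100 + n * (50 * d + 200))%N.

Lemma ram_add_center_spec C s : let C' := rcons C (point (nmem s vX 0)) in
    data s -> ram_output X s = C -> (C != [::] -> costs C s) ->
  let s' := run ram_add_center s in
  [/\ ram_output X s' = C', costs C' s'
    & modifies [:: vCen; vNC; vI; vJ] [:: aDist; aSum; aAcc] 0 add_time s s'].
Proof.
move=> C' sdata outE costsE; rewrite /= /ram_add_center !runE -/ram_update_row.
have NC : nmem s vNC 0 = size C by rewrite -outE size_ram_output.
set s1 := tick _ (rset _ _ _ _).
have mod_s1 : modifies [:: vCen; vNC] [:: aSum] 0 40 s s1 by solve_modifies.
have data1 : data s1 by apply: data_modifies mod_s1 _ _ sdata.
have NC1 : nmem s1 vNC 0 = (size C).+1 by rewrite /= /upd /= NC addn1.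
have out1 : ram_output X s1 = C'.
  rewrite /ram_output NC1 -[(size C).+1]addn1 iotaD map_cat cats1 /C'.
  congr (rcons _ _); last by rewrite /= /upd /= NC eqxx.
  rewrite -[RHS]outE /ram_output NC; apply/eq_in_map => i; rewrite mem_iota /= => lt_i.
  by rewrite /= /upd /= NC (ltn_eqF lt_i).
have dist1 : C != [::] -> forall i, (i < n)%N -> rmem s1 aDist i = mindist C (point i).
  by case/costsE.
have [costs2 mod_s2] := ram_update_rows_spec data1 NC1 erefl dist1.
set s2 := run _ s1 in costs2 mod_s2 *; split=> //.
- by rewrite -out1; apply: (ram_output_modifies mod_s2).
- by rewrite /add_time; solve_modifies.
Qed.

Definition dichotomy_bias : rexp :=
  RDiv (RSub (RGet aSum (nvar vI)) (RGet aSum (nvar vLo)))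
       (RSub (RGet aSum (nvar vHi)) (RGet aSum (nvar vLo))).

Definition dichotomy_step : cmd :=
  If (NLt (NAdd (nvar vLo) N1) (nvar vHi))
    (block [::
      nassign vI (NHalf (NAdd (nvar vLo) (nvar vHi)));
      Flip vCoin dichotomy_bias;
      If (NEq (nvar vCoin) N1)
        (nassign vHi (nvar vI))
        (nassign vLo (nvar vI))])
    Skip.

Definition sample_regs : seq nat := [:: vLo; vHi; vB; vI; vCoin; vX].

Lemma dichotomy_step_flip s lo hi mid (p : R) :
    nmem s vLo 0 = lo -> nmem s vHi 0 = hi -> (lo.+1 < hi)%N -> mid = (lo + hi)./2 ->
    p = (rmem s aSum mid - rmem s aSum lo) / (rmem s aSum hi - rmem s aSum lo) ->
    0 <= p <= 1 ->
  exists s1 s2 : state R, [/\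
    modifies sample_regs [::] 0 70 s s1 /\ modifies sample_regs [::] 0 70 s s2,
    nmem s1 vLo 0 = lo /\ nmem s1 vHi 0 = mid,
    nmem s2 vLo 0 = mid /\ nmem s2 vHi 0 = hi
    & forall F, expect (exec dichotomy_step s) F = p * F s1 + (1 - p) * F s2].
Proof.
move=> loE hiE lt_lh midE pE p01.
pose s0 := run (nassign vI (NHalf (NAdd (nvar vLo) (nvar vHi))))
  (tick (bcost (NLt (NAdd (nvar vLo) N1) (nvar vHi))).+1 s).
pose branch b := run (block [:: If (NEq (nvar vCoin) N1)
    (nassign vHi (nvar vI)) (nassign vLo (nvar vI))])
  (nset vCoin 0 b (tick (rcost dichotomy_bias).+1 s0)).
have mod_branch b : modifies sample_regs [::] 0 70 s (branch b).
  rewrite /branch /s0 runE run_if; case: (beval _ _); rewrite !runE; solve_modifies.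
exists (branch 1%N), (branch 0%N); split=> [|||F].
- by split.
- by rewrite /branch /s0 runE run_if !runE /= /upd /= loE hiE.
- by rewrite /branch /s0 runE run_if !runE /= /upd /= loE hiE.
rewrite exec_if [beval _ _]/= loE hiE addn1 lt_lh exec_seq_run // -/s0.
have biasE : reval s0 dichotomy_bias = p by rewrite /s0 runE /= /upd /= loE hiE pE midE.
by rewrite exec_seq expect_dbind expect_flip biasE // !exec_run // !expect_dret.
Qed.

Lemma dichotomy_step_weighted (w : nat -> R) s lo hi :
    (forall x, 0 <= w x) ->
    (forall j, (j <= hi)%N -> rmem s aSum j = \sum_(0 <= x < j) w x) ->
    nmem s vLo 0 = lo -> nmem s vHi 0 = hi -> (lo.+1 < hi)%N ->
    \sum_(lo <= x < hi) w x != 0 ->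
  let mid := (lo + hi)./2 in
  exists s1 s2 : state R, [/\
    modifies sample_regs [::] 0 70 s s1 /\ modifies sample_regs [::] 0 70 s s2,
    nmem s1 vLo 0 = lo /\ nmem s1 vHi 0 = mid,
    nmem s2 vLo 0 = mid /\ nmem s2 vHi 0 = hi
    & forall F, (\sum_(lo <= x < hi) w x) * expect (exec dichotomy_step s) F
        = (\sum_(lo <= x < mid) w x) * F s1 + (\sum_(mid <= x < hi) w x) * F s2].
Proof.
move=> w_ge0 sumE loE hiE lt_lh W_neq0 mid.
have lo_mid : (lo <= mid)%N by rewrite /mid; lia.
have mid_hi : (mid <= hi)%N by rewrite /mid; lia.
set A := \sum_(lo <= x < mid) w x; set B := \sum_(mid <= x < hi) w x.
have WE : \sum_(lo <= x < hi) w x = A + B by rewrite (big_cat_nat _ (n := mid)).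
have [A_ge0 B_ge0] : 0 <= A /\ 0 <= B by split; apply: sumr_ge0.
have diffE j : (lo <= j <= hi)%N ->
    rmem s aSum j - rmem s aSum lo = \sum_(lo <= x < j) w x.
  move=> /andP [lo_j j_hi]; rewrite !sumE ?(leq_trans lo_j) //.
  by rewrite [X in X - _](big_cat_nat _ (n := lo)) //= addrAC subrr add0r.
rewrite WE in W_neq0 *; have W_gt0 : 0 < A + B by rewrite lt_def W_neq0 addr_ge0.
have p01 : 0 <= A / (A + B) <= 1.
  by rewrite ler_pdivrMr // mul1r lerDl B_ge0 divr_ge0 // ltW.
have pE : A / (A + B)
    = (rmem s aSum mid - rmem s aSum lo) / (rmem s aSum hi - rmem s aSum lo).
  by rewrite !diffE ?lo_mid ?leqnn ?WE // (leq_trans lo_mid).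
have [s1 [s2 [mod_s lohi1 lohi2 expectE]]] :=
  @dichotomy_step_flip s lo hi mid _ loE hiE lt_lh erefl pE p01.
by exists s1, s2; split=> // F; rewrite expectE; field.
Qed.

(* The weight [\sum_(lo <= x < hi) w x] multiplies the expectation because it can
   vanish, and then the division in the coin's bias is by 0. *)
Lemma dichotomy_spec (w : nat -> R) (F : state R -> R) (G : nat -> R) r s lo hi :
    (forall x, 0 <= w x) ->
    (forall j, (j <= hi)%N -> rmem s aSum j = \sum_(0 <= x < j) w x) ->
    nmem s vLo 0 = lo -> nmem s vHi 0 = hi ->
    (lo < hi)%N -> (hi - lo <= 2 ^ size r)%N ->
    (forall s' x, (lo <= x < hi)%N -> nmem s' vLo 0 = x ->
       modifies sample_regs [::] 0 (80 * size r) s s' -> F s' = G x) ->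
  (\sum_(lo <= x < hi) w x)
      * expect (dfold (fun i s' => exec dichotomy_step (tick 1 (nset vB 0 i s'))) r s) F
    = \sum_(lo <= x < hi) w x * G x.
Proof.
move=> w_ge0; elim: r s lo hi => [|i r IHr] s lo hi sumE loE hiE lt_lh le_m FG.
  rewrite (_ : hi = lo.+1); last by rewrite expn0 in le_m; lia.
  rewrite !big_nat1 expect_dret (FG s lo) ?leqnn //.
  by solve_modifies.
rewrite [size _]/= expnS in le_m; rewrite [size _]/= mulnS in FG.
have part s1 a b : modifies sample_regs [::] 0 80 s s1 ->
    nmem s1 vLo 0 = a -> nmem s1 vHi 0 = b -> (lo <= a)%N -> (a < b)%N -> (b <= hi)%N ->
    (b - a <= 2 ^ size r)%N ->
  (\sum_(a <= x < b) w x)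
      * expect (dfold (fun i s' => exec dichotomy_step (tick 1 (nset vB 0 i s'))) r s1) F
    = \sum_(a <= x < b) w x * G x.
  move=> mod_s1 aE bE lo_a lt_ab b_hi le_ab; apply: IHr => // [j j_b|s' x x_in xE mod_s'].
    by rewrite (modifies_rmem mod_s1) // sumE // (leq_trans j_b).
  by apply: (FG s' x) => //; [lia | solve_modifies].
rewrite [dfold _ _ _]/= expect_dbind; set s0 := tick 1 _.
have [lt2|ge2] := ltnP lo.+1 hi; last first.
  rewrite exec_if [beval _ _]/= /upd /= loE hiE addn1 ltnNge ge2 expect_dret.
  by apply: part => //; [solve_modifies | lia].
have [W0|W_neq0] := eqVneq (\sum_(lo <= x < hi) w x) 0.
  rewrite W0 mul0r; move/eqP: W0; rewrite psumr_eq0 // => /allP w_eq0.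
  by rewrite big_seq big1 // => x /w_eq0 /eqP ->; rewrite mul0r.
have [s1 [s2 [[mod_s1 mod_s2] [lo1 mid1] [mid2 hi2] ->]]] :=
  @dichotomy_step_weighted w s0 lo hi w_ge0 sumE loE hiE lt2 W_neq0.
rewrite (part s1 _ _ _ lo1 mid1) ?(part s2 _ _ _ mid2 hi2); try by [solve_modifies | lia].
by rewrite -big_cat_nat //; lia.
Qed.

Lemma coupled_rand a e s : neval s e = n ->
  coupled (exec (Rand a e) s) (uniform R X) (fun s' y =>
    exists i, y = point i /\ s' = tick (ncost e).+1 (nset a 0 i s)).
Proof.
move=> eE F G FG; rewrite [LHS]expect_dmap !expect_uniform eE size_iota.
rewrite [in RHS](big_nth 0) /index_iota subn0; congr (_ * _); apply: eq_bigr => i _.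
by apply: FG; exists i.
Qed.

Definition sample_time : nat := (100 * (up_log 2 n).+1)%N.

Lemma ram_D2_sample_spec C s :
    C != [::] -> data s -> nmem s vLN 0 = up_log 2 n -> costs C s ->
  coupled (exec ram_D2_sample s) (D2_sample X C) (fun s' y =>
    y = point (nmem s' vX 0) /\ modifies sample_regs [::] 0 sample_time s s').
Proof.
move=> C_neq0 [sN _ _ _] sLN [_ sumE]; rewrite exec_if [beval _ _]/= sN sumE //.
have PhiE : Phi C X = \sum_(0 <= j < n) mindist C (point j) by rewrite [LHS](big_nth 0).
rewrite -PhiE; case: eqP => [Phi0|/eqP Phi_neq0].
  rewrite /D2_sample Phi0 eqxx.
  apply: coupled_mono (@coupled_rand vX (nvar vN) (tick _ s) sN) _.
  move=> s' y [i [-> ->]]; split=> //; rewrite /sample_time; solve_modifies.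
move=> F G FG; rewrite expect_D2_sample // 2?exec_seq_run // exec_seq exec_for.
rewrite -/dichotomy_bias -/dichotomy_step; set s1 := tick _ (run _ _).
have mod_s1 : modifies sample_regs [::] 0 20 s s1 by rewrite /s1 !runE; solve_modifies.
rewrite (_ : neval _ _ = up_log 2 n); last exact: sLN.
apply: (mulfI Phi_neq0); rewrite mulrA divff // mul1r {1}PhiE expect_dbind.
rewrite [in RHS](big_nth 0); apply: dichotomy_spec => //.
- by move=> x; apply: mindist_ge0.
- by move: Phi_neq0; rewrite PhiE; case: (n) => //; rewrite big_nil eqxx.
- by rewrite subn0 size_iota up_logP.
move=> s' x _ xE mod_s'; rewrite exec_run // expect_dret !runE size_iota in mod_s' *.
apply: FG; split; first by rewrite /= /upd /= xE.
by rewrite /sample_time; solve_modifies.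
Qed.

(* The distances are meaningless before the first center is added. *)
Definition represents (o : seq 'rV[R]_d * nat) (t : nat) s : Prop :=
  [/\ data s, nmem s vLN 0 = up_log 2 n /\ nmem s vLK 0 = up_log 2 k,
      (ram_output X s, queries s) = o, o.1 != [::] -> costs o.1 s
    & (time s <= t)%N].

Lemma represents_leq o t t' s : (t <= t')%N -> represents o t s -> represents o t' s.
Proof. by move=> le_t [? ? ? ? time_le]; split=> //; apply: leq_trans le_t. Qed.

Lemma represents_modifies ns rs C q q' t t' s s' : modifies ns rs q' t' s s' ->
    ~~ has (mem ns) [:: vN; vK; vD; vLN; vLK; vCen; vNC] ->
    ~~ has (mem rs) [:: aPt; aDist; aSum] ->
  represents (C, q) t s -> represents (C, q + q')%N (t + t')%N s'.
Proof.
move=> mod_s /=; rewrite !orbF !negb_or.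
move=> /and5P [nN nK nD nLN /and3P [nLK nCen nNC]] /and3P [rPt rDist rSum].
move=> [sdata [LN LK] [outE qE] costsE time_le]; split=> /=.
- by apply: data_modifies mod_s _ _ sdata; rewrite //= !orbF !negb_or nN nK.
- by rewrite !(modifies_nmem mod_s).
- by rewrite (ram_output_modifies mod_s) // (modifies_queries mod_s) outE qE.
- move=> /costsE [distE sumE]; split=> i i_le; rewrite (modifies_rmem mod_s) //.
    exact: distE.
  exact: sumE.
- by have := modifies_time mod_s; lia.
Qed.

Lemma represents_add_center C q t s : represents (C, q) t s ->
  represents (rcons C (point (nmem s vX 0)), q) (t + add_time) (run ram_add_center s).
Proof.
move=> [sdata logs [outE qE] costsE time_le].
have [out' costs' mod_s'] := ram_add_center_spec sdata outE costsE.
move: (run ram_add_center s) => s' in out' costs' mod_s' *; split=> //=.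
- by apply: data_modifies mod_s' _ _ sdata.
- by rewrite !(modifies_nmem mod_s').
- by rewrite out' (modifies_queries mod_s') qE addn0.
- by have := modifies_time mod_s'; lia.
Qed.

Definition ram_try_center : cmd := block [::
  ram_check;
  If (NEq (nvar vFound) N0)
    (block [:: ram_add_center; nassign vDone N1])
    Skip].

Definition check_time : nat := (50 * k.+1 + 20)%N.

Lemma ram_try_center_spec C q t s : let y := point (nmem s vX 0) in
    let s' := run ram_try_center s in
    represents (C, q) t s -> nmem s vDone 0 = 0%N -> (size C <= k)%N ->
  if covered cl C (cl y) then
    represents (C, q + size C)%N (t + check_time) s' /\ nmem s' vDone 0 = 0%N
  else
    represents (rcons C y, q + size C)%N (t + check_time + add_time) s'
    /\ nmem s' vDone 0 = 1%N.
Proof.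
move=> y s' rep_s done0 C_le_k; have [_ _ [outE _] _ _] := rep_s.
have NC : nmem s vNC 0 = size C by rewrite -outE size_ram_output.
have [foundE mod_s1] := ram_check_spec same s; rewrite NC in mod_s1.
have {}foundE : nmem (run ram_check s) vFound 0 = nat_of_bool (covered cl C (cl y)).
  by rewrite foundE -outE /covered has_map.
have done1 : nmem (run ram_check s) vDone 0 = 0%N by rewrite (modifies_nmem mod_s1).
rewrite /s' run_seq; move: (run ram_check s) => s1 in mod_s1 foundE done1 *.
rewrite run_seq run_if [beval _ _]/= foundE; case: (covered _ _ _).
  rewrite !runE; set s2 := tick 1 _; split=> //.
  have mod_s2 : modifies [:: vFound; vC; vAns] [::] (size C) check_time s s2.
    by rewrite /check_time; solve_modifies.
  exact: represents_modifies mod_s2 isT isT rep_s.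
rewrite run_seq; set s2 := tick _ s1.
have mod_s2 : modifies [:: vFound; vC; vAns] [::] (size C) (50 * (size C).+1 + 10) s s2.
  by solve_modifies.
have rep_s2 := represents_modifies mod_s2 isT isT rep_s.
have := represents_add_center rep_s2; rewrite [nmem s2 _ _](modifies_nmem mod_s2) // -/y.
move: (run ram_add_center s2) => s3 rep_s3; rewrite !runE; set s4 := tick 1 _.
have mod_s4 : modifies [:: vDone] [::] 0 10 s3 s4 by solve_modifies.
have := represents_modifies mod_s4 isT isT rep_s3; rewrite addn0 => rep_s4.
by split=> //; apply: represents_leq rep_s4; rewrite /check_time; lia.
Qed.

Definition ram_try : cmd :=
  If (NEq (nvar vDone) N0) (Seq ram_D2_sample ram_try_center) Skip.

Definition ram_tries (r : seq nat) s : dist R (state R) :=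
  dfold (fun i s' => exec ram_try (tick 1 (nset vS 0 i s'))) r s.

Definition try_time : nat := (sample_time + check_time + 20)%N.

Lemma ram_tries_done r o t s : represents o t s -> nmem s vDone 0 = 1%N ->
  exists2 s', ram_tries r s = dret R s' & represents o (t + size r * try_time) s'.
Proof.
case: o => C q; elim: r t s => [|i r IHr] t s rep_s done1.
  by exists s => //; rewrite addn0.
set s1 := tick 1 (tick (bcost (NEq (nvar vDone) N0)).+1 (tick 1 (nset vS 0 i s))).
have mod_s1 : modifies [:: vS] [::] 0 try_time s s1.
  by rewrite /try_time /check_time; solve_modifies.
have := represents_modifies mod_s1 isT isT rep_s; rewrite addn0 => rep_s1.
have [s2 triesE rep_s2] := IHr _ _ rep_s1 done1; exists s2; last by rewrite mulSn addnA.
rewrite /ram_tries /= exec_if [beval _ _]/= /upd /= done1 exec_run // dbind_dret.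
exact: triesE.
Qed.

Lemma inner_loop_coupled r C q t s :
    represents (C, q) t s -> nmem s vDone 0 = 0%N -> C != [::] -> (size C <= k)%N ->
  coupled (ram_tries r s) (inner_loop X cl (size r) (C, q)) (fun s' o =>
    [/\ represents o (t + size r * try_time + add_time) s',
        (size o.1 <= (size C).+1)%N & o.1 != [::]]).
Proof.
move=> + + C_neq0 C_le_k; elim: r q t s => [|i r IHr] q t s rep_s done0.
  apply: coupled_dret; split=> //; apply: represents_leq rep_s; lia.
rewrite /ram_tries /= exec_if [beval _ _]/= /upd /= done0 exec_seq dbindA.
set s1 := tick _ _.
have mod_s1 : modifies [:: vS] [::] 0 10 s s1 by solve_modifies.
have rep_s1 := represents_modifies mod_s1 isT isT rep_s.
have [data1 [LN1 _] _ costs1 _] := rep_s1.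
have sampled := ram_D2_sample_spec C_neq0 data1 LN1 (costs1 C_neq0).
apply: (coupled_dbind sampled) => s2 _ [-> mod_s2].
have rep_s2 := represents_modifies mod_s2 isT isT rep_s1; rewrite !addn0 in rep_s2.
have done2 : nmem s2 vDone 0 = 0%N by rewrite (modifies_nmem mod_s2).
rewrite exec_run // dbind_dret -/(covered cl C _).
have := ram_try_center_spec rep_s2 done2 C_le_k; case: ifP => _ [rep_s3 done3].
  apply: coupled_mono (IHr _ _ _ rep_s3 done3) _ => s4 o [rep_s4 size_o o_neq0].
  by split=> //; apply: represents_leq rep_s4; rewrite mulSn /try_time; lia.
have [s4 triesE rep_s4] := ram_tries_done r rep_s3 done3.
rewrite -/(ram_tries r _) triesE; apply: coupled_dret; rewrite size_rcons rcons_neq0.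
by split=> //; apply: represents_leq rep_s4; rewrite mulSn /try_time; lia.
Qed.

Definition ram_extend : cmd := block [:: nassign vDone N0; For vS (nvar vLK) ram_try].

Definition extend_time : nat := (up_log 2 k * try_time + add_time + 50)%N.

Lemma outer_loop_coupled r C q t s :
    represents (C, q) t s -> C != [::] -> (size C + size r <= k)%N ->
  coupled (dfold (fun i s' => exec ram_extend (tick 1 (nset vT 0 i s'))) r s)
    (outer_loop X cl (size r) (C, q))
    (fun s' o => represents o (t + size r * extend_time) s').
Proof.
elim: r C q t s => [|i r IHr] C q t s rep_s C_neq0 C_le_k.
  by apply: coupled_dret; rewrite addn0.
apply: (@coupled_dbind _ _ _ _ _ _ _ _ _ (fun s' o =>
    [/\ represents o (t + extend_time) s',
        (size o.1 <= (size C).+1)%N & o.1 != [::]])); last first.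
  move=> s' [C' q'] [rep_s' size_C' C'_neq0]; rewrite mulSn addnA.
  by apply: IHr => //; rewrite /= in C_le_k size_C'; lia.
rewrite exec_seq_run // exec_seq exec_for !runE; set s1 := tick (ncost (nvar vLK)).+1 _.
have mod_s1 : modifies [:: vT; vDone] [::] 0 20 s s1 by rewrite /s1; solve_modifies.
have rep_s1 := represents_modifies mod_s1 isT isT rep_s; rewrite addn0 in rep_s1.
rewrite (_ : neval _ _ = up_log 2 k); last by case: rep_s1 => _ [].
rewrite -[in inner_loop _ _ _](size_iota 0 (up_log 2 k)).
have size_C : (size C <= k)%N by apply: leq_trans (leq_addr _ _) C_le_k.
rewrite -/(ram_tries _ _).
apply: (coupled_dbindl (inner_loop_coupled rep_s1 erefl C_neq0 size_C))
  => s2 [C2 q2] [rep_s2 size_C2 C2_neq0].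
rewrite exec_run //; apply: coupled_dret; split=> //.
have := represents_modifies (modifies_tick 1 (modifies_refl [::] [::] s2)) isT isT rep_s2.
by rewrite addn0 size_iota; apply: represents_leq; rewrite /extend_time; lia.
Qed.

Definition setup_time : nat := (50 * k.+1 + 50 * n.+1 + 10)%N.

Lemma represents_setup : represents ([::], 0%N) setup_time
  (run (nassign vNC N0) (run (ram_log vLN vN) (run (ram_log vLK vK) (ram_input k X)))).
Proof.
set s0 := ram_input k X; have data0 : data s0 := data_ram_input.
have [n0 k0 _ _] := data0.
have [LK1 mod_s1] := @ram_log_spec _ same vLK vK s0 isT.
move: (run (ram_log _ _) s0) => s1 in LK1 mod_s1 *.
have n1 : nmem s1 vN 0 = n by rewrite (modifies_nmem mod_s1).
have [LN2 mod_s2] := @ram_log_spec _ same vLN vN s1 isT.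
move: (run (ram_log _ _) s1) => s2 in LN2 mod_s2 *.
rewrite ?k0 ?n1 in LK1 LN2 mod_s1 mod_s2; rewrite runE; set s3 := tick _ _.
have mod_s3 : modifies [:: vLK; vLN; vPow; vI; vNC] [::] 0 setup_time s0 s3.
  by rewrite /setup_time; solve_modifies.
split=> //.
- by apply: data_modifies mod_s3 _ _ data0.
- by split; [exact: LN2 | rewrite -LK1; apply: (modifies_nmem mod_s2)].
- by rewrite (modifies_queries mod_s3).
- by have := modifies_time mod_s3.
Qed.

Definition total_time : nat := (setup_time + 40 + add_time + k.-1 * extend_time)%N.

Lemma ram_query_kmeanspp_coupled : (0 < k)%N ->
  coupled (exec ram_query_kmeanspp (ram_input k X)) (query_kmeanspp X cl)
    (fun s o => (ram_output X s, queries s) = o /\ (time s <= total_time)%N).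
Proof.
move=> k_gt0; rewrite /ram_query_kmeanspp 3?exec_seq_run // exec_seq.
have := represents_setup; move: (run (nassign vNC N0) _) => s3 rep_s3.
have [[n3 _ _ _] _ _ _ _] := rep_s3.
apply: (coupled_dbind (@coupled_rand vX (nvar vN) s3 n3)) => _ y [x [-> ->]].
set s4 := tick _ _; have mod_s4 : modifies [:: vX] [::] 0 10 s3 s4 by solve_modifies.
have rep_s4 := represents_modifies mod_s4 isT isT rep_s3.
have := represents_add_center rep_s4; rewrite exec_seq_run //.
move: (run ram_add_center s4) => s5 rep_s5.
rewrite exec_seq exec_for; set s6 := tick _ s5.
have mod_s6 : modifies [::] [::] 0 10 s5 s6 by solve_modifies.
have rep_s6 := represents_modifies mod_s6 isT isT rep_s5.
have [[_ k5 _ _] _ _ _ _] := rep_s5.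
rewrite (_ : neval _ _ = k.-1); last by rewrite /= k5 subn1.
rewrite -[in outer_loop _ _ _](size_iota 0 k.-1).
apply: (coupled_dbindl (outer_loop_coupled rep_s6 isT _)) => [|s7 [C q] rep_s7].
  by rewrite size_iota /=; lia.
rewrite exec_run //; apply: coupled_dret.
case: rep_s7 => _ _ outE _ time_le; split; first exact: outE.
by rewrite /= /total_time; rewrite size_iota in time_le; lia.
Qed.

End Implementation.
(** * Query complexity and running time *)

Section Queries.
Variables (R : realFieldType) (d k : nat) (X : seq 'rV[R]_d) (cl : 'rV[R]_d -> 'I_k).

Lemma inner_loop_queries_le m C q :
  all (fun p => (size p.2.1 <= (size C).+1) && (p.2.2 <= q + m * size C))%N
    (inner_loop X cl m (C, q)).
Proof.
elim: m q => [|m IHm] q /=; first by rewrite leqnSn addn0 leqnn.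
rewrite all_dbind; apply/allP => p _ /=; case: ifP => _.
  by apply: sub_all (IHm _) => o /=; rewrite mulSn addnA.
by rewrite /= size_rcons leqnn mulSn addnA leq_addr.
Qed.

Lemma outer_loop_queries_le m C q : (size C + m <= k)%N ->
  all (fun p => p.2.2 <= q + m * (up_log 2 k * k))%N (outer_loop X cl m (C, q)).
Proof.
elim: m C q => [|m IHm] C q C_le_k /=; first by rewrite addn0 leqnn.
rewrite all_dbind; apply: sub_all (inner_loop_queries_le _ _ _) => -[w [C' q']] /=.
case/andP => size_C' q'_le; apply: sub_all (IHm C' q' _); last by lia.
move=> o /= /leq_trans; apply; rewrite mulSn addnA leq_add2r.
by apply: leq_trans q'_le _; rewrite leq_add2l leq_mul2l; lia.
Qed.

Lemma query_kmeanspp_queries_le : (0 < k)%N ->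
  all (fun p => p.2.2 <= k * (up_log 2 k * k))%N (query_kmeanspp X cl).
Proof.
move=> k_gt0; rewrite all_dbind; apply/allP => p _ /=.
apply: sub_all (outer_loop_queries_le _ _) => [o /= /leq_trans|]; last by rewrite /=; lia.
by apply; rewrite add0n leq_mul2r leq_pred orbT.
Qed.

End Queries.

Lemma total_time_le (R : realFieldType) (d k : nat) (X : seq 'rV[R]_d) :
    (0 < size X)%N -> (0 < d)%N -> (1 < k)%N ->
  (total_time k X <= 2000 * (size X * k * d + k * up_log 2 k * up_log 2 (size X)
                              + k * k * up_log 2 k))%N.
Proof.
move=> n_gt0 d_gt0 k_gt1; have L_gt0 : (0 < up_log 2 k)%N by rewrite up_log_gt0.
rewrite /total_time /setup_time /extend_time /try_time /sample_time /check_time /add_time.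
move: (size X) (up_log 2 (size X)) (up_log 2 k) n_gt0 L_gt0 => n LN L n_gt0 L_gt0.
rewrite -(ltn_predK k_gt1) -(prednK n_gt0) -(prednK d_gt0) -(prednK L_gt0) /=.
move: k.-1 n.-1 d.-1 L.-1 => k' n' d' L'; nia.
Qed.

Section LogarithmicBounds.
Variable R : realType.

Definition up_log_factor : R := 2 / ln 2.

Let b := up_log_factor.

Lemma up_log_factor_ge0 : 0 <= b.
Proof. by rewrite divr_ge0 // ln_ge0 // ler1n. Qed.

Lemma up_log_le_ln m : (up_log 2 m)%:R <= b * ln m%:R.
Proof.
have [m_le1|m_gt1] := leqP m 1.
  case: m m_le1 => [|[|]] // _; last by rewrite up_log1 ln1 mulr0.
  by rewrite up_log0 ln0 ?mulr0.
have m_gt0 : 0 < m%:R :> R by rewrite ltr0n ltnW.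
have ln2_gt0 : 0 < ln 2 :> R by rewrite ln_gt0 // ltr1n.
rewrite /b /up_log_factor mulrAC ler_pdivlMr //.
have ln2_le : ln 2 <= ln m%:R :> R by rewrite ler_ln ?posrE // ler_nat.
have predE : (up_log 2 m).-1.+1 = up_log 2 m by rewrite prednK // up_log_gt0.
have : (up_log 2 m).-1%:R * ln 2 <= ln m%:R :> R.
  rewrite mulr_natl -lnXn // ler_ln ?posrE ?exprn_gt0 //.
  by rewrite -natrX ler_nat ltnW // up_log_gtn.
by rewrite -predE -natr1; lra.
Qed.

Lemma sqr_up_log_le_ln k :
  (k * (up_log 2 k * k))%:R <= b * (k%:R ^+ 2 * ln k%:R) :> R.
Proof.
rewrite mulnCA natrM natrM -expr2 mulrC mulrCA ler_wpM2l ?sqr_ge0 //.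
exact: up_log_le_ln.
Qed.

Lemma up_logM_le_ln k n : (k * up_log 2 k * up_log 2 n)%:R
  <= b ^+ 2 * (k%:R * ln k%:R * ln n%:R) :> R.
Proof.
rewrite (_ : b ^+ 2 * _ = k%:R * ((b * ln k%:R) * (b * ln n%:R))); last by ring.
by rewrite !natrM -mulrA ler_wpM2l // ler_pM // up_log_le_ln.
Qed.

Lemma total_time_le_ln d k (X : seq 'rV[R]_d) :
    (0 < size X)%N -> (0 < d)%N -> (1 < k)%N ->
  (total_time k X)%:R <= 2000 * (1 + b + b ^+ 2) *
    ((size X)%:R * k%:R * d%:R + k%:R * ln k%:R * ln (size X)%:R
     + k%:R ^+ 2 * ln k%:R).
Proof.
move=> n_gt0 d_gt0 k_gt1; have := total_time_le n_gt0 d_gt0 k_gt1.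
rewrite -(ler_nat R) => /le_trans; apply.
rewrite natrM !natrD -mulrA ler_wpM2l // !natrM.
have := up_logM_le_ln k (size X).
have := sqr_up_log_le_ln k; rewrite mulnCA mulnC !natrM.
have lnk_ge0 : 0 <= ln k%:R :> R by rewrite ln_ge0 // ler1n ltnW.
have lnn_ge0 : 0 <= ln (size X)%:R :> R by rewrite ln_ge0 // ler1n.
set u := (size X)%:R * _ * _; set v := k%:R * ln k%:R * _; set z := k%:R ^+ 2 * _.
have u_ge0 : 0 <= u by rewrite !mulr_ge0.
have v_ge0 : 0 <= v by rewrite !mulr_ge0.
have z_ge0 : 0 <= z by rewrite !mulr_ge0 ?sqr_ge0.
have b_ge0 := up_log_factor_ge0; have b2_ge0 := sqr_ge0 b.
have bu := mulr_ge0 b_ge0 u_ge0; have b2u := mulr_ge0 b2_ge0 u_ge0.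
have bv := mulr_ge0 b_ge0 v_ge0; have b2z := mulr_ge0 b2_ge0 z_ge0.
lra.
Qed.

End LogarithmicBounds.

Theorem theorem6 (R : realType) :
  exists c : R,
  forall (n d k : nat) (X : n.-tuple 'rV[R]_d) (cl : 'rV[R]_d -> 'I_k),
    (0 < n)%N -> (0 < d)%N -> (1 < k)%N -> uniq X -> optimal_clustering X cl ->
    [/\ expect (query_kmeanspp X cl) (fun o => Phi o.1 X) <= 24 * Delta k X,
        surely (query_kmeanspp X cl)
          (fun o => o.2%:R <= c * (k%:R ^+ 2 * ln k%:R)),
        forall o : seq 'rV[R]_d * nat,
          pmf (dmap fst (ram_run X cl)) o = pmf (query_kmeanspp X cl) o
      & surely (ram_run X cl)
          (fun o => o.2%:R <=
             c * (n%:R * k%:R * d%:R + k%:R * ln k%:R * ln n%:R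
                  + k%:R ^+ 2 * ln k%:R))].
Proof.
pose b := up_log_factor R; have b_ge0 : 0 <= b := up_log_factor_ge0 R.
exists (2000 * (1 + b + b ^+ 2)) => n d k X cl n_gt0 d_gt0 k_gt1 _ opt.
have size_gt0 : (0 < size X)%N by rewrite size_tuple.
have X_neq0 : X != [::] :> seq _ by rewrite -size_eq0 -lt0n.
have k_gt0 : (0 < k)%N := ltnW k_gt1.
have runs_coupled := ram_query_kmeanspp_coupled (X := X) cl k_gt0.
split.
- by rewrite -opt; apply: query_kmeanspp_cost_le.
- move=> w o /(allP (query_kmeanspp_queries_le X cl k_gt0)) /= queries_le _.
  apply: (@le_trans _ _ (b * (k%:R ^+ 2 * ln k%:R))).
    by apply: le_trans (sqr_up_log_le_ln R k); rewrite ler_nat.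
  rewrite ler_wpM2r ?mulr_ge0 ?sqr_ge0 ?ln_ge0 ?ler1n //.
  have := sqr_ge0 b; lra.
- move=> o; rewrite /ram_run dmap_comp; apply: coupled_pmf.
  by apply: coupled_mono runs_coupled _ => s t [].
- apply: (coupled_surely (P := fun o => o.2%:R <= _) (nonneg_exec _ _ _) runs_coupled).
  move=> s o [_ time_le]; have := total_time_le_ln size_gt0 d_gt0 k_gt1.
  rewrite size_tuple; apply: le_trans; rewrite ler_nat; exact: time_le.
Qed.
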